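(* The $G$-orbit of a pair $(C,D)\in\mathfrak{C}$ is included in $\mathfrak{C}$. As a consequence, the projection $\pi(\mathfrak{C})$ of $\mathfrak{C}$ on $\mathcal{M}$ is a Zariski closed set and is defined by the following equation, whose left-hand side is an irreducible polynomial: $$-\lambda_1^2\lambda_2^2+2\lambda_1^2\lambda_2\lambda_3-\lambda_1^2\lambda_3^2+2\lambda_1\lambda_2^2\lambda_3+2\lambda_1\lambda_2\lambda_3^2-\lambda_2^2\lambda_3^2=0 .$$ Moreover, this equation defines a smooth algebraic set in $\mathcal{M}$.
   Context: A conic in $\mathbb{CP}^2$ is identified with its symmetric $3\times 3$ complex matrix up to a non-zero scalar. $\mathfrak{O}\subset\mathbb{CP}^5\times\mathbb{CP}^5$ is the open set of pairs $(C,D)$ of non-degenerate conics that intersect transversely, i.e. in four distinct points. $G=\mathbb{P}GL_3(\mathbb{C})$ acts on $\mathfrak{O}$ by congruence, $(C,D)\mapsto(A^TCA,A^TDA)$; $\mathcal{M}=\mathfrak{O}/G$ and $\pi:\mathfrak{O}\to\mathcal{M}$ is the canonical projection. Sending the orbit of $(C,D)$ to the class $[\lambda_1:\lambda_2:\lambda_3]$ of the three (distinct, non-zero) roots of $\det(tC+D)$ identifies $\mathcal{M}$ with the open subset $U/S_3$ of $\mathbb{CP}^2/S_3$, where $U\subset\mathbb{CP}^2$ is the set of points with distinct non-zero coordinates and $S_3$ permutes coordinates; $\mathcal{M}$ carries the structure of this quotient. Writing $\sqrt{\det(tC+D)}=A_0+A_1t+A_2t^2+\cdots$ for the Taylor expansion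 at $t=0$, the Cayley set is $\mathfrak{C}=\{(C,D)\in\mathfrak{O}: A_2=0\}$; equivalently, with $\det(tC+D)=\sigma_{3,0}t^3+\sigma_{2,1}t^2+\sigma_{1,2}t+\sigma_{0,3}$, it is defined in $\mathfrak{O}$ by $-\sigma_{1,2}^2+4\sigma_{0,3}\sigma_{2,1}=0$. *)

(* Defs.v *)
From HB Require Import structures.
From mathcomp Require Import all_boot all_order all_algebra perm.
From mathcomp Require Import boolp classical_sets reals.
From mathcomp Require Export complex mpoly.

Set Implicit Arguments.
Unset Strict Implicit.
Unset Printing Implicit Defensive.

Import GRing.Theory.
Local Open Scope quotient_scope.
Local Open Scope classical_set_scope.
Local Open Scope ring_scope.

Section ProjectiveSpace.
Context {K : fieldType} (V : lmodType K).

Definition nonzero := {v : V | v != 0}.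

Definition collinear (u v : nonzero) : bool :=
  `[< exists2 a : K, a != 0 & val u = a *: val v >].

Fact collinear_refl : reflexive collinear.
Proof. by move=> u; apply/asboolP; exists 1; rewrite ?oner_neq0 ?scale1r. Qed.

Fact collinear_sym : ssrbool.symmetric collinear.
Proof.
move=> u v; apply: asbool_equiv_eq; split=> -[a a0 E];
  by exists a^-1; rewrite ?invr_eq0 // E scalerA mulVf ?scale1r.
Qed.

Fact collinear_trans : transitive collinear.
Proof.
move=> v u w /asboolP[a a0 E] /asboolP[b b0 E'].
by apply/asboolP; exists (a * b); rewrite ?mulf_neq0 // E E' scalerA.
Qed.

Canonical collinear_equiv :=
  EquivRel collinear collinear_refl collinear_sym collinear_trans.

Definition proj := {eq_quot collinear}.

(* Homogeneous coordinates: a chosen one, and all the possible ones. *)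
Definition rep (x : proj) : V := val (repr x).
Definition represents (v : V) (x : proj) : Prop :=
  exists2 a : K, a != 0 & v = a *: rep x.

Lemma rep_neq0 x : rep x != 0.
Proof. exact: (valP (repr x)). Qed.

Lemma represents_exists (v : V) : v != 0 -> exists x, represents v x.
Proof.
move=> v0; exists (\pi_proj (exist _ v v0)).
have /eqmodP/asboolP := reprK (\pi_proj (exist (fun v => v != 0) v v0)).
case=> a a0 E; exists a^-1; first by rewrite invr_eq0.
by rewrite /rep E scalerA mulVf // scale1r.
Qed.

End ProjectiveSpace.

Section Pairs.
Variable K : fieldType.

Let point := proj 'cV[K]_3.
Let P_M3 := proj 'M[K]_3.

Definition conic (C : P_M3) : Prop := (rep C)^T = rep C.
Definition nondegenerate (C : P_M3) : Prop := rep C \in unitmx.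
Definition on_conic (x : point) (C : P_M3) : Prop :=
  (rep x)^T *m rep C *m rep x = 0.

Definition transverse (C D : P_M3) : Prop :=
  exists s : seq point, [/\ uniq s, size s = 4%N &
    forall x, x \in s <-> on_conic x C /\ on_conic x D].

Definition OO : set (P_M3 * P_M3) :=
  [set CD | [/\ conic CD.1, conic CD.2, nondegenerate CD.1,
                nondegenerate CD.2 & transverse CD.1 CD.2]].

Definition PGL3 : set P_M3 := [set A | rep A \in unitmx].

Definition congruent_by (A C C' : P_M3) : Prop :=
  represents ((rep A)^T *m rep C *m rep A) C'.

Definition G_orbit (CD : P_M3 * P_M3) : set (P_M3 * P_M3) :=
  [set CD' | exists A, [/\ PGL3 A, congruent_by A CD.1 CD'.1
                         & congruent_by A CD.2 CD'.2]].

Lemma congruent_byP (A : 'M[K]_3) (g C C' : P_M3) : represents A g ->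
  congruent_by g C C' <-> represents (A^T *m rep C *m A) C'.
Proof.
case=> a a0 ->.
rewrite /congruent_by [(a *: rep g)^T]linearZ /= -!scalemxAl -!scalemxAr scalerA.
split=> -[b b0 E].
  by exists (a * a * b); rewrite ?mulf_neq0 // E scalerA.
exists ((a * a)^-1 * b); first by rewrite mulf_neq0 // invr_eq0 mulf_neq0.
by rewrite -scalerA -E scalerA mulVf ?mulf_neq0 // scale1r.
Qed.

Lemma G_orbitP (CD CD' : P_M3 * P_M3) : G_orbit CD CD' <->
  exists A : 'M[K]_3, [/\ A \in unitmx,
    represents (A^T *m rep CD.1 *m A) CD'.1 &
    represents (A^T *m rep CD.2 *m A) CD'.2].
Proof.
split=> [[g [g1 g2 g3]]|[A [A1 A2 A3]]]; first by exists (rep g).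
have A0 : A != 0.
  by apply: contraTneq A1 => ->; rewrite unitmxE det0 unitr0.
have [g Ag] := represents_exists A0; exists g; split; last 2 first.
- exact/(congruent_byP _ _ Ag).
- exact/(congruent_byP _ _ Ag).
case: Ag A1 => a a0 ->; rewrite !unitmxE detZ unitrM => /andP[_].
by rewrite /PGL3 /= unitmxE.
Qed.

Lemma G_orbit_refl CD : G_orbit CD CD.
Proof.
apply/G_orbitP; exists 1%:M; rewrite unitmx1 !trmx1 !mul1mx !mulmx1.
by split=> //; exists 1; rewrite ?oner_neq0 ?scale1r.
Qed.

Lemma G_orbit_sym CD CD' : G_orbit CD CD' -> G_orbit CD' CD.
Proof.
move=> /G_orbitP[A [A1 A2 A3]]; apply/G_orbitP; exists (invmx A).
have H (C C' : P_M3) : represents (A^T *m rep C *m A) C' ->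
    represents ((invmx A)^T *m rep C' *m invmx A) C.
  case=> a a0 E; exists a^-1; first by rewrite invr_eq0.
  have -> : rep C' = a^-1 *: (A^T *m rep C *m A).
    by rewrite E scalerA mulVf // scale1r.
  rewrite -scalemxAr -scalemxAl !mulmxA -trmx_mul mulmxV // trmx1 mul1mx.
  by rewrite -mulmxA mulmxV // mulmx1.
by rewrite unitmx_inv; split=> //; exact: H.
Qed.

Lemma G_orbit_trans CD1 CD2 CD3 :
  G_orbit CD1 CD2 -> G_orbit CD2 CD3 -> G_orbit CD1 CD3.
Proof.
move=> /G_orbitP[A [A1 A2 A3]] /G_orbitP[B [B1 B2 B3]].
apply/G_orbitP; exists (A *m B).
have H (C C' C'' : P_M3) : represents (A^T *m rep C *m A) C' ->
    represents (B^T *m rep C' *m B) C'' ->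
    represents ((A *m B)^T *m rep C *m (A *m B)) C''.
  case=> a a0 E [b b0 E']; exists (a * b); first by rewrite mulf_neq0.
  rewrite trmx_mul -scalerA -E' scalemxAl scalemxAr -E.
  by rewrite !mulmxA.
by rewrite unitmx_mul A1 B1; split=> //; [exact: H A2 B2|exact: H A3 B3].
Qed.

Definition OO_type := {CD : P_M3 * P_M3 | CD \in OO}.

Definition same_orbit (x y : OO_type) : bool := `[< G_orbit (val x) (val y) >].

Fact same_orbit_refl : reflexive same_orbit.
Proof. by move=> x; apply/asboolP/G_orbit_refl. Qed.

Fact same_orbit_sym : ssrbool.symmetric same_orbit.
Proof. by move=> x y; apply: asbool_equiv_eq; split; apply: G_orbit_sym. Qed.

Fact same_orbit_trans : transitive same_orbit.
Proof.
by move=> y x z /asboolP xy /asboolP yz; apply/asboolP/(G_orbit_trans xy yz).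
Qed.

Canonical same_orbit_equiv :=
  EquivRel same_orbit same_orbit_refl same_orbit_sym same_orbit_trans.

Definition MM := {eq_quot same_orbit}.

Definition projM (x : OO_type) : MM := \pi_MM x.

Definition pencil (CD : P_M3 * P_M3) : {poly K} :=
  \det ('X *: map_mx polyC (rep CD.1) + map_mx polyC (rep CD.2)).

(* The square roots of p in K[[t]].  Over the complex numbers, when p(0) != 0,
   there are two of them, opposite to each other: the Taylor expansions at 0
   of the two branches of the square root of p. *)
Definition sqrt_series (p : {poly K}) (A : nat -> K) : Prop :=
  forall n, \sum_(i < n.+1) A i * A (n - i)%N = p`_n.

Definition Cayley : set (P_M3 * P_M3) :=
  [set CD | OO CD /\ exists2 A, sqrt_series (pencil CD) A & A 2%N = 0].

Definition Cayley_image : set MM := projM @` [set x | Cayley (val x)].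

End Pairs.

Arguments Cayley K _ : clear implicits.
Arguments Cayley_image K _ : clear implicits.

Section Quotient.
Variable K : fieldType.

Let P2 := proj 'rV[K]_3.
Definition coord (l : P2) (i : 'I_3) : K := rep l 0 i.
Local Notation "P `( x )" := (meval (coord x) P)
  (at level 2, format "P `( x )").

Definition UU : set P2 :=
  [set l | (forall i, coord l i != 0) /\ injective (coord l)].

Definition perm_coord (x y : P2) : bool :=
  [exists s : 'S_3, `[< represents (col_perm s (rep x)) y >]].

Fact perm_coord_refl : reflexive perm_coord.
Proof.
move=> x; apply/existsP; exists 1%g; apply/asboolP.
by rewrite col_perm1; exists 1; rewrite ?oner_neq0 ?scale1r.
Qed.

Fact perm_coord_sym : ssrbool.symmetric perm_coord.
Proof.
have H x y : perm_coord x y -> perm_coord y x.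
  case/existsP=> s /asboolP[a a0 E]; apply/existsP; exists s^-1%g.
  apply/asboolP; exists a^-1; first by rewrite invr_eq0.
  have -> : rep y = a^-1 *: col_perm s (rep x).
    by rewrite E scalerA mulVf // scale1r.
  by rewrite linearZ /= -col_permM mulVg col_perm1.
by move=> x y; apply/idP/idP; apply: H.
Qed.

Fact perm_coord_trans : transitive perm_coord.
Proof.
move=> y x z /existsP[s /asboolP[a a0 E]] /existsP[t /asboolP[b b0 E']].
apply/existsP; exists (t * s)%g; apply/asboolP.
exists (a * b); first by rewrite mulf_neq0.
by rewrite col_permM E linearZ /= E' scalerA.
Qed.

Canonical perm_coord_equiv :=
  EquivRel perm_coord perm_coord_refl perm_coord_sym perm_coord_trans.

Definition P2_S3 := {eq_quot perm_coord}.

Definition qS3 (l : P2) : P2_S3 := \pi_P2_S3 l.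

Definition US3 : set P2_S3 := qS3 @` UU.

(* Closed sets of U/S_3, for the quotient of the Zariski topology of U. *)
Definition closed_US3 (S : set P2_S3) : Prop :=
  S `<=` US3 /\
  exists I : set {mpoly K[3]},
    (forall P, I P -> exists d, P \is d.-homog) /\
    forall l, UU l -> (S (qS3 l) <-> forall P, I P -> P`(l) = 0).

Definition irreducible_US3 (S : set P2_S3) : Prop :=
  [/\ closed_US3 S, S !=set0 &
      forall A B, closed_US3 A -> closed_US3 B -> S = A `|` B ->
        S = A \/ S = B].

Definition irreducible_chain (p : P2_S3) (Z : set P2_S3) (n : nat)
    (c : nat -> set P2_S3) : Prop :=
  [/\ forall i, (i <= n)%N -> irreducible_US3 (c i),
      c 0%N p, c n `<=` Z & forall i, (i < n)%N -> c i `<` c i.+1].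

(* The local dimension of Z at p, i.e. the Krull dimension of O_(Z,p). *)
Definition local_dimension (Z : set P2_S3) (p : P2_S3) (d : nat) : Prop :=
  (exists c, irreducible_chain p Z d c) /\
  forall n c, irreducible_chain p Z n c -> (n <= d)%N.

(* f is regular around p in U/S_3: its pullback to U is a quotient of two
   homogeneous polynomials of the same degree around each point above p.
   Only the germ of f at p is constrained. *)
Definition regular_at (p : P2_S3) (f : P2_S3 -> K) : Prop :=
  US3 p /\ forall l, UU l -> qS3 l = p ->
  exists (d : nat) (P Q : {mpoly K[3]}),
    [/\ P \is d.-homog, Q \is d.-homog, Q`(l) != 0 &
        forall l', UU l' -> Q`(l') != 0 -> f (qS3 l') = P`(l') / Q`(l')].

(* The maximal ideal of O_(Z,p) = O_(U/S_3,p) / I(Z) has d generators. *)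
Definition maximal_ideal_generated (Z : set P2_S3) (p : P2_S3) (d : nat) :=
  exists t : 'I_d -> P2_S3 -> K,
    (forall i, regular_at p (t i) /\ t i p = 0) /\
    forall g, regular_at p g -> g p = 0 ->
    exists h : 'I_d -> P2_S3 -> K,
      (forall i, regular_at p (h i)) /\
      exists B, [/\ closed_US3 B, ~ B p &
        forall x, Z x -> ~ B x -> g x = \sum_(i < d) h i x * t i x].

(* Z is smooth at p when O_(Z,p) is a regular local ring. *)
Definition smooth_US3 (Z : set P2_S3) : Prop :=
  closed_US3 Z /\ forall p, Z p ->
    exists2 d, local_dimension Z p d & maximal_ideal_generated Z p d.

(* l = [v_0 : v_1 : v_2] for the roots v_i of det(tC + D), with (C, D) in the
   orbit m.  Other matrices for C and D multiply all the roots by a constant,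
   and l is only defined up to a permutation of the coordinates. *)
Definition root_class (m : MM K) (l : P2) : Prop :=
  exists x : OO_type K, projM x = m /\
  exists2 v : 'rV[K]_3, represents v l &
    pencil (val x) =
      lead_coef (pencil (val x)) *: \prod_(i < 3) ('X - (v 0 i)%:P).

(* The identification of the space of orbits with U/S_3, on subsets; the space
   of orbits carries the geometric structure of U/S_3 through it. *)
Definition in_US3 (S : set (MM K)) : set P2_S3 :=
  [set n | exists m l, [/\ S m, root_class m l & n = qS3 l]].

Definition zariski_closed (S : set (MM K)) : Prop := closed_US3 (in_US3 S).
Definition smooth_algebraic (S : set (MM K)) : Prop := smooth_US3 (in_US3 S).

Definition zero_locus (F : {mpoly K[3]}) : set (MM K) :=
  [set m | exists2 l, root_class m l & F`(l) = 0].

End Quotient.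

Definition irreducible_mpoly {n : nat} {K : fieldType} (F : {mpoly K[n]}) :=
  [/\ F != 0, F \isn't a GRing.unit &
      forall A B, F = A * B -> A \is a GRing.unit \/ B \is a GRing.unit].

Definition Cayley_poly {K : fieldType} : {mpoly K[3]} :=
  let l1 := 'X_(inord 0) in let l2 := 'X_(inord 1) in
  let l3 := 'X_(inord 2) in
  - l1 ^+ 2 * l2 ^+ 2 + 2%:R * l1 ^+ 2 * l2 * l3 - l1 ^+ 2 * l3 ^+ 2
  + 2%:R * l1 * l2 ^+ 2 * l3 + 2%:R * l1 * l2 * l3 ^+ 2 - l2 ^+ 2 * l3 ^+ 2.

(* Main.v *)
(* The polynomial is [4 * e1 * e3 - e2 ^+ 2] in the elementary symmetric functions
   of the roots, so it vanishes exactly when the coefficients of the pencil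
   satisfy the Cayley condition; congruence and rescaling act on the coefficient
   of [t ^ i] by a factor [c * k ^ i], which preserves this condition.

   The roots are distinct: moving the four base points to the coordinate points
   and [1 : 1 : 1] turns the two conics into [f0 y z + f1 x z + f2 x y] and
   [g0 y z + g1 x z + g2 x y] with [f0 + f1 + f2 = g0 + g1 + g2 = 0], and the
   roots are the [- gi / fi].  Conversely these normal forms realize every
   triple of distinct non-zero roots.

   The inverses of the coordinates of a zero have the form [b0 ^ 2], [b1 ^ 2],
   [b2 ^ 2] with [b0 + b1 + b2 = 0].  One factor of the polynomial vanishes on
   this parametrized curve; as it has two distinct zeros in each variable, the
   other factor is constant.

   On the curve [Z] defined by the polynomial in the quotient by the symmetric
   group, the function [j = e2 ^ 3 / e3 ^ 2] is injective and takes all values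
   but [54].  A symmetric form of degree [6 k] restricts on [Z] to [e3 ^ (2 k)]
   times a polynomial in [j].  Hence the proper closed subsets of [Z] are finite,
   which gives local dimension 1, and germs of functions on [Z] are fractions
   in [j], so that [j - j(p)] generates the maximal ideal at [p], even at the
   point [j = 0] where the stabilizer is not trivial. *)
From mathcomp Require Import all_boot all_algebra.
From mathcomp Require Import classical_sets reals.
From mathcomp Require Import order perm boolp ring zify.
Require Import Defs.

Set Implicit Arguments.
Unset Strict Implicit.
Unset Printing Implicit Defensive.

Import Order.TTheory GRing.Theory Num.Theory.
Local Open Scope classical_set_scope.
Local Open Scope ring_scope.

(** * Elementary symmetric functions of three variables *)

Local Notation i0 := (inord 0 : 'I_3).
Local Notation i1 := (inord 1 : 'I_3).
Local Notation i2 := (inord 2 : 'I_3).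

Lemma big_ord3 (T : Type) (idx : T) (op : Monoid.law idx) (f : 'I_3 -> T) :
  \big[op/idx]_(i < 3) f i = op (op (f i0) (f i1)) (f i2).
Proof.
rewrite !big_ord_recl big_ord0 Monoid.mulm1 Monoid.mulmA.
by congr (op (op (f _) (f _)) (f _)); apply: val_inj; rewrite /= inordK.
Qed.

Lemma ord3P (P : 'I_3 -> Prop) : P i0 -> P i1 -> P i2 -> forall i, P i.
Proof.
move=> P0 P1 P2 [[|[|[|//]]] lti].
- by have <- : i0 = Ordinal lti by apply: val_inj; rewrite /= inordK.
- by have <- : i1 = Ordinal lti by apply: val_inj; rewrite /= inordK.
- by have <- : i2 = Ordinal lti by apply: val_inj; rewrite /= inordK.
Qed.

Definition vec3 (T : Type) (x y z : T) (i : 'I_3) : T :=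
  if i == i0 then x else if i == i1 then y else z.

Lemma vec3E (T : Type) (x y z : T) :
  (vec3 x y z i0 = x) * (vec3 x y z i1 = y) * (vec3 x y z i2 = z).
Proof. by rewrite /vec3 -!val_eqE /= !inordK. Qed.

Lemma vec3_eta (T : Type) (f : 'I_3 -> T) : f =1 vec3 (f i0) (f i1) (f i2).
Proof. by apply: ord3P; rewrite vec3E. Qed.

Section SymmetricFunctions.
Variable K : fieldType.
Implicit Types f : 'I_3 -> K.

Definition esym1 f := f i0 + f i1 + f i2.
Definition esym2 f := f i0 * f i1 + f i1 * f i2 + f i0 * f i2.
Definition esym3 f := f i0 * f i1 * f i2.

Lemma prod_XsubC3 f : \prod_(i < 3) ('X - (f i)%:P) =
  'X^3 - (esym1 f)%:P * 'X^2 + (esym2 f)%:P * 'X - (esym3 f)%:P.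
Proof. rewrite big_ord3 /esym1 /esym2 /esym3 /=; ring. Qed.

Lemma coef_prod_XsubC3 f : let p := \prod_(i < 3) ('X - (f i)%:P) in
  (p`_0 = - esym3 f) * (p`_1 = esym2 f) * (p`_2 = - esym1 f).
Proof.
do !split; rewrite prod_XsubC3
  !(coefB, coefD, coefCM, coefXn, coefX, coefC) /=.
all: ring.
Qed.

Lemma meval_mesym f : ((mesym 3 K 1).@[f] = esym1 f) *
  ((mesym 3 K 2).@[f] = esym2 f) * ((mesym 3 K 3).@[f] = esym3 f).
Proof.
have E (k : 'I_4) := mroots_coeff [tuple f i | i < 3] k.
have ET (g : {mpoly K[3]}) : g.@[tnth [tuple f i | i < 3]] = g.@[f].
  by apply: meval_eq => i; rewrite tnth_mktuple.
have EP : \prod_(c <- [tuple f i | i < 3]) ('X - c%:P) = \prod_(i < 3) ('X - (f i)%:P).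
  by rewrite big_tuple; apply: eq_bigr => i _; rewrite tnth_mktuple.
have := E (inord 1); have := E (inord 2); have := E (inord 3).
rewrite EP !inordK // !ET !coef_prod_XsubC3 !exprS expr0.
by rewrite !(mulN1r, mulr1, opprK, mul1r) => /oppr_inj <- <- /oppr_inj <-.
Qed.

Lemma Cayley_polyE f :
  Cayley_poly.@[f] = 4%:R * esym1 f * esym3 f - esym2 f ^+ 2.
Proof.
rewrite /Cayley_poly !(mevalD, mevalB, mevalN, mevalM, rmorphXn, rmorph_nat) /=.
rewrite !mevalXU.
rewrite /esym1 /esym2 /esym3; ring.
Qed.

End SymmetricFunctions.

(** * Homogeneous coordinates of projective points *)

Section Projective.
Variables (K : fieldType) (V : lmodType K).
Implicit Types (v w : V) (x y : proj V).

Lemma represents_rep x : represents (rep x) x.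
Proof. by exists 1; rewrite ?oner_neq0 ?scale1r. Qed.

Lemma representsZ a v x : a != 0 -> represents v x -> represents (a *: v) x.
Proof. by move=> a0 [b b0 ->]; exists (a * b); rewrite ?mulf_neq0 ?scalerA. Qed.

Lemma represents_inj v x y : represents v x -> represents v y -> x = y.
Proof.
move=> [a a0 ->] [b b0 E]; rewrite -[x]reprK -[y]reprK; apply/eqmodP/asboolP.
exists (a^-1 * b); rewrite ?mulf_neq0 ?invr_eq0 //.
by rewrite -scalerA -[val (repr y)]/(rep y) -E scalerA mulVf // scale1r.
Qed.

End Projective.

(** * Forms under scaling and permutation of the coordinates *)

Section Evaluation.
Variable K : fieldType.
Implicit Types (f : 'I_3 -> K) (P : {mpoly K[3]}).

Lemma meval_homog n d (P : {mpoly K[n]}) (f : 'I_n -> K) a : P \is d.-homog ->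
  P.@[fun i => a * f i] = a ^+ d * P.@[f].
Proof.
move=> /dhomogP Ph; rewrite !mevalE mulr_sumr !big_seq.
apply: eq_bigr => m /Ph dm; rewrite mulrCA; congr (_ * _).
have -> : d = (\sum_i m i)%N by rewrite -mdegE; exact/esym.
rewrite -prodrXr -big_split /=.
by apply: eq_bigr => i _; rewrite exprMn.
Qed.

Lemma meval_msym n s (P : {mpoly K[n]}) (f : 'I_n -> K) :
  (msym s P).@[f] = P.@[fun i => f (s i)].
Proof.
rewrite -[msym s P]comp_mpoly_id msym_mPo comp_mpoly_meval.
by apply: meval_eq => i; rewrite !tnth_mktuple mevalXU.
Qed.

Lemma qS3P (l l' : proj 'rV[K]_3) : qS3 l = qS3 l' <->
  exists (s : 'S_3) (a : K), a != 0 /\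
    coord l \o s =1 fun i => a * coord l' i.
Proof.
split=> [/eqmodP/existsP[s /asboolP[a a0 E]]|[s [a [a0 E]]]].
  exists s, a; split=> // i; move/rowP/(_ i): E.
  by rewrite !mxE.
apply/eqmodP/existsP; exists s; apply/asboolP; exists a => //.
by apply/rowP => i; rewrite !mxE; exact: E.
Qed.

Lemma UU_qS3 (l l' : proj 'rV[K]_3) : qS3 l = qS3 l' -> UU l -> UU l'.
Proof.
move=> /qS3P[s [a [a0 E]]] [l0 linj]; split=> [i|i j].
  by have := l0 (s i); have /= -> := E i; rewrite mulf_eq0 negb_or => /andP[].
move=> Eij; apply: (@perm_inj _ s); apply: linj.
by have /= -> := E i; have /= -> := E j; rewrite Eij.
Qed.

Lemma US3_qS3 (l : proj 'rV[K]_3) : US3 (qS3 l) <-> UU l.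
Proof. by split=> [[l' l'U /UU_qS3]|lU]; [exact|exists l]. Qed.

Lemma esymZ f a : (esym1 (fun i => a * f i) = a * esym1 f) *
  (esym2 (fun i => a * f i) = a ^+ 2 * esym2 f) *
  (esym3 (fun i => a * f i) = a ^+ 3 * esym3 f).
Proof. by do !split; rewrite /esym1 /esym2 /esym3; ring. Qed.

Lemma eq_esym f g : f =1 g ->
  (esym1 f = esym1 g) * (esym2 f = esym2 g) * (esym3 f = esym3 g).
Proof. by move=> E; do !split; rewrite /esym1 /esym2 /esym3 !E. Qed.

Lemma esym_perm f (s : 'S_3) : (esym1 (f \o s) = esym1 f) *
  (esym2 (f \o s) = esym2 f) * (esym3 (f \o s) = esym3 f).
Proof.
have E k : (mesym 3 K k).@[f \o s] = (mesym 3 K k).@[f].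
  by rewrite -[RHS](congr1 (meval f) (issymP _ (mesym_sym _ _ _) s)) meval_msym.
by do !split; rewrite -!meval_mesym E.
Qed.

Lemma esym_qS3 (l l' : proj 'rV[K]_3) : qS3 l = qS3 l' -> exists2 a : K, a != 0 &
  [/\ esym1 (coord l) = a * esym1 (coord l'),
      esym2 (coord l) = a ^+ 2 * esym2 (coord l') &
      esym3 (coord l) = a ^+ 3 * esym3 (coord l')].
Proof.
move=> /qS3P[s [a [a0 E]]]; exists a => //.
by rewrite -!(esym_perm (coord l) s) !(eq_esym E) !esymZ.
Qed.

Lemma Cayley_poly_qS3 (l l' : proj 'rV[K]_3) : qS3 l = qS3 l' ->
  Cayley_poly.@[coord l] = 0 -> Cayley_poly.@[coord l'] = 0.
Proof.
move=> /esym_qS3[a a0 [E1 E2 E3]]; rewrite !Cayley_polyE E1 E2 E3 => /eqP H.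
have {}H : a ^+ 4 * (4%:R * esym1 (coord l') * esym3 (coord l')
    - esym2 (coord l') ^+ 2) == 0 by rewrite -(eqP H); apply/eqP; ring.
by move: H; rewrite mulf_eq0 expf_eq0 /= (negPf a0) => /eqP.
Qed.

(** Both families are the roots of the same monic cubic, so unique factorization matches them up to
    order. *)
Lemma eq_esym_perm f g : esym1 f = esym1 g -> esym2 f = esym2 g ->
  esym3 f = esym3 g -> exists s : 'S_3, f \o s =1 g.
Proof.
move=> E1 E2 E3; pose tf := [tuple f i | i < 3]; pose tg := [tuple g i | i < 3].
have : perm_eq tg tf.
  apply: prod_XsubC_eq; rewrite !big_tuple.
  under eq_bigr do rewrite tnth_mktuple.
  under [RHS]eq_bigr do rewrite tnth_mktuple.
  by rewrite !prod_XsubC3 E1 E2 E3.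
move/tuple_permP => [s E]; exists s => i.
have /(congr1 (fun t => tnth t i)) : tg = [tuple tnth tf (s i) | i < 3].
  exact: val_inj.
by rewrite !tnth_mktuple.
Qed.

End Evaluation.

(** * Closed sets of the quotient *)

Section ClosedSets.
Variable K : fieldType.
Implicit Types (l : proj 'rV[K]_3) (S : set (P2_S3 K)) (P : {mpoly K[3]}).

(** The defining family may be enlarged to all forms vanishing on [S], so closedness means that one
    form separates [S] from each point outside it. *)
Lemma closed_US3P S : closed_US3 S <-> S `<=` @US3 K /\
  forall l, UU l -> ~ S (qS3 l) -> exists d P, [/\ P \is d.-homog,
    P.@[coord l] != 0 & forall l', UU l' -> S (qS3 l') -> P.@[coord l'] = 0].
Proof.
split=> [[SU [I [Ih IS]]]|[SU H]]; split=> //.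
  move=> l lU; rewrite IS // => /existsNP[P] /not_implyP[IP /eqP P0].
  have [d Pd] := Ih _ IP; exists d, P; split=> // l' l'U /(IS _ l'U).
  exact.
exists [set P | (exists d, P \is d.-homog) /\
  forall l', UU l' -> S (qS3 l') -> P.@[coord l'] = 0]; split=> [P []//|l lU].
split=> [Sl P [_]|Hl]; first exact.
apply: contrapT => /(H _ lU)[d [P [Pd /eqP P0 PS]]]; apply: P0; apply: Hl.
by split=> //; exists d.
Qed.

Lemma closed_US3_homog d P : P \is d.-homog ->
  (forall l l', qS3 l = qS3 l' -> P.@[coord l] = 0 -> P.@[coord l'] = 0) ->
  closed_US3 [set x | exists l, [/\ UU l, P.@[coord l] = 0 & x = qS3 l]].
Proof.
move=> Pd PS; apply/closed_US3P; split=> [_ [l [lU _ ->]]|l lU Sl].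
  exact/US3_qS3.
exists d, P; split=> // [|l' l'U [l'' [_ Pl'' /esym/PS]]]; last exact.
by apply: contra_notN Sl => /eqP Pl; exists l.
Qed.

Lemma closed_US3I S1 S2 :
  closed_US3 S1 -> closed_US3 S2 -> closed_US3 (S1 `&` S2).
Proof.
move=> /closed_US3P[S1U H1] /closed_US3P[S2U H2]; apply/closed_US3P.
split=> [x [/S1U]//|l lU /not_andP[/(H1 _ lU)|/(H2 _ lU)] [d [P [Pd Pl PS]]]];
  by exists d, P; split=> // l' l'U [? ?]; apply: PS.
Qed.

(** A nonzero minor [g p * f q - g q * f p] provides the linear form; if all minors vanish, the
    vectors are proportional. *)
Lemma linear_separation (f g : 'I_3 -> K) :
  (exists i, f i != 0) -> (exists i, g i != 0) ->
  (exists a, a != 0 /\ g =1 fun i => a * f i) \/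
  exists P, [/\ P \is 1.-homog, P.@[f] != 0 & P.@[g] = 0].
Proof.
move=> [i fi] [j gj].
have [[p [q H]]|H] := pselect (exists p q, g p * f q != g q * f p).
  right; exists (g p *: 'X_q - g q *: 'X_p); split.
  - by rewrite rpredB // dhomogZ // dhomogX /= mdeg1.
  - by rewrite mevalB !mevalZ !mevalXU subr_eq0.
  - by rewrite mevalB !mevalZ !mevalXU mulrC subrr.
have {}H p q : g p * f q = g q * f p.
  by apply: contrapT => /eqP ?; apply: H; exists p, q.
have gi : g i != 0.
  by apply: contra_neq gj => gi; apply: (mulIf fi); rewrite H gi !mul0r.
left; exists (g i / f i); split=> [|k]; first by rewrite mulf_neq0 ?invr_eq0.
by apply: (mulIf fi); rewrite H mulrAC divfK.
Qed.

Lemma coord_neq0 l : exists i, coord l i != 0.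
Proof.
apply: contrapT => H; have /eqP := rep_neq0 l; apply; apply/rowP => i.
by apply/eqP; rewrite mxE; apply: contra_notT H => ?; exists i.
Qed.

(** For each permutation of [l], some linear form kills the permuted point but not [l1]; the product
    of these forms vanishes on the whole fibre. *)
Lemma closed_US3_point l : UU l -> closed_US3 [set qS3 l].
Proof.
move=> lU; apply/closed_US3P; split=> [_ ->|l1 l1U ll1]; first exact/US3_qS3.
have /choice[P PP] : forall s : 'S_3, exists P, [/\ P \is 1.-homog,
    P.@[coord l1] != 0 & P.@[coord l \o s] = 0].
  move=> s; have [i li] := coord_neq0 l.
  have [||[a [a0 E]]//|//] := @linear_separation (coord l1) (coord l \o s).
  - exact: coord_neq0.
  - by exists (s^-1 i)%g; rewrite /= permKV.
  by case: ll1; apply/esym/qS3P; exists s, a.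
exists #|{perm 'I_3}|, (\prod_s P s); split.
- rewrite -sum1_card -big_enum -[X in _ \is X.-homog]big_enum /=.
  elim: (enum _) => [|s r IH]; first by rewrite !big_nil dhomog1.
  by rewrite !big_cons dhomogM //; case: (PP s).
- by rewrite rmorph_prod prodf_seq_neq0; apply/allP => s _; case: (PP s).
- move=> l' l'U /= /esym/qS3P[s [a [a0 E]]].
  rewrite rmorph_prod (bigD1 s) //=; case: (PP s) => P1 _.
  rewrite (meval_eq _ E) (meval_homog _ _ P1) expr1 => /eqP.
  by rewrite mulf_eq0 (negPf a0) => /eqP ->; rewrite mul0r.
Qed.

End ClosedSets.

(** * Symmetrization of forms *)

Section Symmetrization.
Variable K : numFieldType.
Implicit Types (l : proj 'rV[K]_3) (P Q : {mpoly K[3]}).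

Lemma sum_msym_sym P : \sum_(s : 'S_3) msym s P \is symmetric.
Proof.
apply/issymP => t; rewrite raddf_sum /=.
rewrite [RHS](reindex_inj (mulIg t)) /=.
by apply: eq_bigr => s _; rewrite msymMm.
Qed.

Lemma dhomog_msym n d (s : 'S_n) (P : {mpoly K[n]}) :
  P \is d.-homog -> msym s P \is d.-homog.
Proof. by rewrite !homog_piE -msym_pihomog => /eqP ->. Qed.

(* The plain symmetrization of [Q] may vanish at [l]; it is first multiplied
   by linear forms killing the other points of the fibre of [l], and raised to
   a power that makes the stabilizer of [l] act trivially on its value. *)
Lemma symmetrization l d Q : UU l -> Q \is d.-homog -> Q.@[coord l] != 0 ->
  exists k e R, [/\ R \is e.-homog, (e + d = 6 * k)%N &
    (\sum_(s : 'S_3) msym s (R * Q)).@[coord l] != 0].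
Proof.
move=> lU Qd Ql; set f := coord l in Ql *.
have f0 : forall i, f i != 0 by case: lU.
pose prop (s : 'S_3) := `[< exists a, a != 0 /\ f \o s =1 fun i => a * f i >].
have /choice[L LP] : forall s : 'S_3, exists P, [/\ P \is 1.-homog,
    P.@[f] != 0 & ~~ prop s -> P.@[f \o s] = 0].
  move=> s; case: (boolP (prop s)) => [_|/asboolP Hs].
    by exists 'X_i0; rewrite dhomogX /= mdeg1 mevalXU.
  have [||//|[P [P1 P2 P3]]] := @linear_separation K f (f \o s).
  - by exists i0.
  - by exists i0; apply: f0.
  by exists P; split.
pose M := \prod_s L s.
have Mh : M \is (#|{perm 'I_3}|).-homog.
  rewrite -sum1_card -big_enum /M -[X in X \is _]big_enum /=.
  elim: (enum _) => [|s r IH]; first by rewrite !big_nil dhomog1.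
  by rewrite !big_cons dhomogM //; case: (LP s).
have Mf : M.@[f] != 0.
  by rewrite rmorph_prod prodf_seq_neq0; apply/allP => s _; case: (LP s).
exists (#|{perm 'I_3}| + d)%N, (#|{perm 'I_3}| + (#|{perm 'I_3}| + d) * 5)%N.
exists (M * (M * Q) ^+ 5).
have -> : M * (M * Q) ^+ 5 * Q = (M * Q) ^+ 6 by rewrite [RHS]exprS mulrAC.
have MQh := dhomogM Mh Qd.
split; [exact/dhomogM/dhomogMn | by rewrite addnAC -mulnS mulnC |].
(* The term of [s] is [(M * Q).@[f] ^+ 6] if [s] only rescales [f], and 0 otherwise. The identity
   counts, so in characteristic 0 the sum is not 0. *)
rewrite raddf_sum /= (eq_bigr (fun s => (M * Q).@[f] ^+ 6 *+ prop s)).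
  rewrite sumrMnr mulrn_eq0 negb_or expf_neq0 ?mevalM ?mulf_neq0 // andbT.
  rewrite (bigD1 (1%g : {perm 'I_3})) //= addn_eq0 negb_and; apply/orP; left.
  rewrite eqb0 negbK; apply/asboolP; exists 1; rewrite oner_neq0; split=> // i.
  by rewrite /= perm1 mul1r.
move=> s _; rewrite meval_msym rmorphXn /=.
case: (boolP (prop s)) => [/asboolP[a [a0 E]]|Hs]; last first.
  have [_ _ /(_ Hs) Ls] := LP s.
  by rewrite mevalM /M rmorph_prod (bigD1 s) //= Ls !mul0r expr0n.
rewrite (meval_eq _ E) (meval_homog _ _ MQh) exprMn -exprM mulnC.
(* [esym3 f] is nonzero and invariant under [s], so its factor [a ^+ 3] is 1 and the sixth power
   absorbs [a]. *)
suff a3 : a ^+ 3 = 1 by rewrite (exprM _ 6) (exprM a 3 2) a3 !expr1n mul1r.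
have p0 : f i0 * f i1 * f i2 != 0 by rewrite !mulf_neq0.
apply: (mulIf p0); have := (esym_perm f s).2; rewrite (eq_esym E) esymZ.
by rewrite mul1r.
Qed.

End Symmetrization.

(** * The Cayley curve *)

Lemma UU_exists (K : fieldType) (f : 'I_3 -> K) :
  (forall i, f i != 0) -> injective f ->
  exists l a, [/\ UU l, a != 0, represents (\row_i f i) l &
                  f =1 fun i => a * coord l i].
Proof.
move=> f0 finj.
have [|l fl] := @represents_exists K 'rV[K]_3 (\row_i f i).
  by apply/eqP => /rowP/(_ i0)/eqP; rewrite !mxE (negPf (f0 _)).
have [a a0 E] := fl.
have {}E i : f i = a * coord l i by move/rowP/(_ i): E; rewrite !mxE.
exists l, a; split=> //; split=> [i|i j Eij].
  by have := f0 i; rewrite E mulf_eq0 negb_or => /andP[].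
by apply: finj; rewrite !E Eij.
Qed.

Lemma ord3_inj (T : eqType) (f : 'I_3 -> T) :
  f i0 != f i1 -> f i0 != f i2 -> f i1 != f i2 -> injective f.
Proof.
move=> /eqP n01 /eqP n02 /eqP n12.
by apply: ord3P; apply: ord3P => // /esym.
Qed.

Lemma Cayley_polyZ (K : fieldType) (f : 'I_3 -> K) a :
  Cayley_poly.@[fun i => a * f i] = a ^+ 4 * Cayley_poly.@[f].
Proof. by rewrite !Cayley_polyE !esymZ; ring. Qed.

Lemma esym3_neq0 (K : fieldType) (l : proj 'rV[K]_3) :
  UU l -> esym3 (coord l) != 0.
Proof. by case=> l0 _; rewrite !mulf_neq0. Qed.

(* On the curve [esym2 ^+ 2 = 4 * esym1 * esym3], this function of degree 0 is
   a coordinate: scaling [esym3] to 1 leaves [esym2] up to a cube root of 1. *)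
Definition jinv (K : fieldType) (f : 'I_3 -> K) : K :=
  esym2 f ^+ 3 / esym3 f ^+ 2.

Definition jmap (K : fieldType) (x : P2_S3 K) : K := jinv (coord (repr x)).

Definition Cayley_curve (K : fieldType) : set (P2_S3 K) :=
  [set x | exists l, [/\ UU l, Cayley_poly.@[coord l] = 0 & x = qS3 l]].

(** * The function j and polynomials in it *)

Section Coordinate.
Variable K : fieldType.
Implicit Types (l : proj 'rV[K]_3) (N : {poly K}).

Lemma ratio_scale (a x y : K) : a != 0 ->
  (a ^+ 2 * x) ^+ 3 / (a ^+ 3 * y) ^+ 2 = x ^+ 3 / y ^+ 2.
Proof.
move=> a0; have -> : (a ^+ 2 * x) ^+ 3 = a ^+ 6 * x ^+ 3 by ring.
have -> : (a ^+ 3 * y) ^+ 2 = a ^+ 6 * y ^+ 2 by ring.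
by rewrite -mulf_div divff ?mul1r ?expf_neq0.
Qed.

Lemma jinvZ (f : 'I_3 -> K) a : a != 0 -> jinv (fun i => a * f i) = jinv f.
Proof. by move=> a0; rewrite /jinv !esymZ ratio_scale. Qed.

Lemma jmapE l : jmap (qS3 l) = jinv (coord l).
Proof.
have /esym_qS3[a a0 [_ E2 E3]] : qS3 (repr (qS3 l)) = qS3 l by exact: reprK.
by rewrite /jmap /jinv E2 E3 ratio_scale.
Qed.

(** For [n] at least the degree of [N], this is [N] at [esym2 ^+ 3 / esym3 ^+ 2], cleared of
    denominators by [esym3 ^+ (2 * n)]. *)
Definition jhomog N n : {mpoly K[3]} :=
  \sum_(i < n.+1) N`_i *: (mesym 3 K 2 ^+ (3 * i) * mesym 3 K 3 ^+ (2 * (n - i))).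

Lemma jhomog_homog N n : jhomog N n \is (6 * n).-homog.
Proof.
apply: rpred_sum => i _; rewrite dhomogZ //.
have -> : (6 * n = 2 * (3 * i) + 3 * (2 * (n - i)))%N.
  by have := ltn_ord i; rewrite ltnS => /subnKC {1}<-; rewrite mulnDr !mulnA.
by apply: dhomogM; apply/dhomogMn/dhomog_mesym.
Qed.

Lemma jhomogE N n l : UU l -> (size N <= n.+1)%N ->
  (jhomog N n).@[coord l] = esym3 (coord l) ^+ (2 * n) * N.[jinv (coord l)].
Proof.
move=> /esym3_neq0 l3 sN; rewrite (horner_coef_wide _ sN) mulr_sumr raddf_sum /=.
apply: eq_bigr => i _; rewrite mevalZ mevalM !rmorphXn /= !meval_mesym.
rewrite [RHS]mulrCA; congr (_ * _); rewrite /jinv expr_div_n -!exprM.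
have -> : (2 * n = 2 * (n - i) + 2 * i)%N by rewrite -mulnDr subnK // -ltnS.
by rewrite exprD mulrACA divff ?mulr1 1?mulrC ?expf_neq0.
Qed.

Definition jlocus N : set (P2_S3 K) := [set x | US3 x /\ N.[jmap x] = 0].

Lemma closed_jlocus N : closed_US3 (jlocus N).
Proof.
apply/closed_US3P; split=> [x []//|l lU Hl].
exists (6 * size N)%N, (jhomog N (size N)); split; first exact: jhomog_homog.
  rewrite jhomogE // mulf_neq0 ?expf_neq0 ?esym3_neq0 //.
  by apply: contra_notN Hl => /eqP Nl; split; [exact/US3_qS3|rewrite jmapE].
by move=> l' l'U [_]; rewrite jmapE jhomogE // => ->; rewrite mulr0.
Qed.

End Coordinate.

(** * Values of j on the curve, irreducibility and dimension *)

Section Curve.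
Variable K : numClosedFieldType.
Implicit Types (l : proj 'rV[K]_3) (x : P2_S3 K) (N : {poly K}) (S : set (P2_S3 K)).

Local Notation Z := (@Cayley_curve K).

Lemma Cayley_poly_homog : (@Cayley_poly K) \is 4.-homog.
Proof.
have X i : ('X_i : {mpoly K[3]}) \is 1.-homog by rewrite dhomogX /= mdeg1.
pose M (a b c d : 'I_3) : {mpoly K[3]} := 'X_a * 'X_b * 'X_c * 'X_d.
have MP a b c d : M a b c d \is 4.-homog.
  exact: dhomogM (dhomogM (dhomogM (X a) (X b)) (X c)) (X d).
have -> : Cayley_poly = - M i0 i0 i1 i1 + M i0 i0 i1 i2 *+ 2 - M i0 i0 i2 i2
    + M i0 i1 i1 i2 *+ 2 + M i0 i1 i2 i2 *+ 2 - M i1 i1 i2 i2.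
  by rewrite /Cayley_poly /M; ring.
by do ?[apply: rpredD | rewrite rpredN | apply: rpredMn | apply: MP].
Qed.

Lemma closed_Cayley_curve : closed_US3 Z.
Proof. exact: closed_US3_homog Cayley_poly_homog (@Cayley_poly_qS3 K). Qed.

(** On the curve [esym1] is determined by [esym2] and [esym3]. A factor [k] scaling these two with
    weights 2 and 3 thus makes [f] a permutation of [k * g]. *)
Lemma jmap_inj : {in Z &, injective (@jmap K)}.
Proof.
move=> _ _ /set_mem[l [lU lC ->]] /set_mem[l' [l'U l'C ->]].
rewrite !jmapE /jinv; set f := coord l in lC *; set g := coord l' in l'C *.
have f3 : esym3 f != 0 by exact: esym3_neq0.
have g3 : esym3 g != 0 by exact: esym3_neq0.
move/eqP; rewrite eqr_div ?expf_neq0 // => /eqP Ej.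
have esym1E (h : 'I_3 -> K) : esym3 h != 0 -> Cayley_poly.@[h] = 0 ->
    esym1 h = esym2 h ^+ 2 / (4%:R * esym3 h).
  rewrite Cayley_polyE => h3 /eqP; rewrite subr_eq0 => /eqP <-.
  by field; rewrite h3 /=.
have f1 := esym1E f f3 lC; have g1 := esym1E g g3 l'C.
have [k [k0 E2 E3]] : exists k, [/\ k != 0, esym2 f = k ^+ 2 * esym2 g &
    esym3 f = k ^+ 3 * esym3 g].
  have [f2|f2] := eqVneq (esym2 f) 0.
    have g2 : esym2 g = 0.
      move: Ej; rewrite f2 expr0n mul0r => /esym/eqP.
      by rewrite mulf_eq0 !expf_eq0 /= (negPf f3) orbF => /eqP.
    exists (3.-root (esym3 f / esym3 g)); rewrite rootC_eq0 // rootCK //.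
    by rewrite f2 g2 mulr0 divfK // mulf_neq0 ?invr_eq0.
  have g2 : esym2 g != 0.
    apply: contra_neq f2 => g2; apply/eqP; move: Ej.
    rewrite g2 expr0n mul0r => /eqP.
    by rewrite mulf_eq0 !expf_eq0 /= (negPf g3) orbF.
  (* [esym3 / esym2] has weight 1, so its ratio is the only candidate; the equality of the [jinv]
     values makes it fit both weights. *)
  exists (esym3 f * esym2 g / (esym2 f * esym3 g)); split.
  - exact: mulf_neq0 (mulf_neq0 f3 g2) (invr_neq0 (mulf_neq0 f2 g3)).
  - have D : (esym2 f * esym3 g) ^+ 2 != 0 by apply/expf_neq0/mulf_neq0.
    apply: (mulfI D); transitivity (esym2 f ^+ 3 * esym3 g ^+ 2); first by ring.
    by rewrite Ej; field; rewrite f2 g3.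
  - have D : (esym2 f * esym3 g) ^+ 3 != 0 by apply/expf_neq0/mulf_neq0.
    apply: (mulfI D).
    transitivity (esym2 f ^+ 3 * esym3 g ^+ 2 * (esym3 g * esym3 f)); first by ring.
    by rewrite Ej; field; rewrite f2 g3.
have E1 : esym1 f = k * esym1 g.
  rewrite f1 g1 E2 E3; field.
  by rewrite k0 g3 /=.
have [s Es] : exists s : 'S_3, f \o s =1 fun i => k * g i.
  by apply: eq_esym_perm; rewrite esymZ.
by apply/qS3P; exists s, k.
Qed.

(** The inverses of the triple given to [vec3] are proportional to the squares of [s], [1],
    [- (s + 1)], which puts it on the curve, and its [jinv] is [8 * (s ^+ 2 + s + 1) ^+ 3 / (s * (s
    + 1)) ^+ 2]. A root [s] of [p] makes this value equal to [y]. *)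
Lemma jinv_surj y : y != 54%:R ->
  exists l, [/\ UU l, Cayley_poly.@[coord l] = 0 & jinv (coord l) = y].
Proof.
move=> /eqP y54.
have nat0 n : n%:R = 0 :> K -> n = 0%N by move/eqP; rewrite pnatr_eq0 => /eqP.
pose p : {poly K} := 8%:R *: ('X^2 + 'X + 1) ^+ 3 - y *: ('X * ('X + 1)) ^+ 2.
have pE t : p.[t] = 8%:R * (t ^+ 2 + t + 1) ^+ 3 - y * (t * (t + 1)) ^+ 2.
  by rewrite /p !(hornerE, hornerXn, horner_exp).
have /closed_rootP[s] : size p != 1%N.
  apply/eqP => p1; have [c _ pc] := size_poly1P _ (introT eqP p1).
  have E t : p.[t] = c by rewrite pc hornerC.
  (* The combination [p.[2] - 9 * p.[1] + 8 * p.[0]] is 0 for a constant, while in [p] the terms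
     with [y] cancel and leave 864. *)
  have := nat0 864; suff -> : 864%:R = 0 :> K by move/(_ erefl).
  transitivity (p.[2%:R] - 9%:R * p.[1] + 8%:R * p.[0]); last by rewrite !E; ring.
  by rewrite !pE; ring.
rewrite /root pE => /eqP Es.
have s0 : s != 0.
  apply/eqP => s0; have /nat0 // : 8%:R = 0 :> K.
  by rewrite -[RHS]Es s0; ring.
have s1 : s + 1 != 0.
  apply/eqP => s1; have /nat0 // : 8%:R = 0 :> K; rewrite -[RHS]Es.
  have -> : s = -1 by apply/eqP; rewrite -addr_eq0; apply/eqP.
  by ring.
(* Up to nonzero factors these are the differences of the coordinates. Twice the square of their
   product is [8 * (s ^+ 2 + s + 1) ^+ 3 - 54 * (s * (s + 1)) ^+ 2], so a coincidence would force
   [y = 54]. *)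
have d1 : (s - 1) * (s + 2%:R) * (2%:R * s + 1) != 0.
  apply/eqP => d1; apply: y54; have w0 : (s * (s + 1)) ^+ 2 != 0.
    by rewrite expf_neq0 ?mulf_neq0.
  apply: (mulIf w0); move/eqP: Es; rewrite subr_eq0 => /eqP <-.
  apply/eqP; rewrite -subr_eq0; apply/eqP.
  transitivity (2%:R * ((s - 1) * (s + 2%:R) * (2%:R * s + 1)) ^+ 2); last first.
    by rewrite d1; ring.
  by ring.
have [||l [a [lU a0 _ El]]] :=
  @UU_exists K (vec3 ((s + 1) ^+ 2) (s ^+ 2 * (s + 1) ^+ 2) (s ^+ 2)).
- by apply: ord3P; rewrite vec3E ?mulf_neq0 ?expf_neq0.
- move: d1; rewrite !mulf_eq0 !negb_or => /andP[/andP[sn1 sn2] sn3].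
  apply: ord3_inj; rewrite !vec3E -subr_eq0.
  + have -> : (s + 1) ^+ 2 - s ^+ 2 * (s + 1) ^+ 2 = - (s + 1) ^+ 3 * (s - 1) by ring.
    by rewrite mulf_neq0 // oppr_eq0 expf_neq0.
  + by have -> : (s + 1) ^+ 2 - s ^+ 2 = 2%:R * s + 1 by ring.
  + have -> : s ^+ 2 * (s + 1) ^+ 2 - s ^+ 2 = s ^+ 3 * (s + 2%:R) by ring.
    by rewrite mulf_neq0 ?expf_neq0.
exists l; split=> //.
  apply: (mulfI (expf_neq0 4 a0)); rewrite -Cayley_polyZ -(meval_eq _ El) mulr0.
  by rewrite Cayley_polyE /esym1 /esym2 /esym3 !vec3E; ring.
rewrite -(jinvZ _ a0) /jinv -!(eq_esym El) /esym2 /esym3 !vec3E.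
have w0 : (s * (s + 1)) ^+ 2 != 0 by rewrite expf_neq0 ?mulf_neq0.
apply: (mulIf w0); move/eqP: Es; rewrite subr_eq0 => /eqP <-.
by field; rewrite s0 s1.
Qed.

(** Substituting [e2 ^+ 2 / (4 * e3)] for [e1] leaves the power [2 * a + b = 3 * q] of [e2], which
    is a power of [e2 ^+ 3 / e3 ^+ 2] times a power of [e3]. *)
Lemma monomial_on_curve (e1 e2 e3 : K) a b c q k : e3 != 0 ->
  4%:R * e1 * e3 = e2 ^+ 2 -> (2 * a + b = 3 * q)%N -> (c + 2 * q = 2 * k + a)%N ->
  e1 ^+ a * e2 ^+ b * e3 ^+ c = 4%:R ^- a * (e3 ^+ (2 * k) * (e2 ^+ 3 / e3 ^+ 2) ^+ q).
Proof.
move=> e30 E Eq Ek; have D : 4%:R ^+ a * e3 ^+ (a + 2 * q) != 0.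
  by rewrite mulf_neq0 ?expf_neq0 // pnatr_eq0.
have p0 : 4%:R ^+ a != 0 :> K by rewrite expf_neq0 // pnatr_eq0.
have p1 : e3 ^+ (2 * q) != 0 by rewrite expf_neq0.
apply: (mulIf D); transitivity (e2 ^+ (3 * q) * e3 ^+ (2 * k + a)).
  rewrite -Eq -Ek (exprD _ (2 * a)) (exprM _ 2) -E !exprMn (exprD _ c) (exprD _ a).
  by ring.
rewrite expr_div_n -!exprM (exprD _ (2 * k)) (exprD _ a).
move: (4%:R ^+ a) p0 (e3 ^+ (2 * q)) p1 => u u0 v v0.
by field; rewrite u0 v0.
Qed.

Lemma symmetric_on_curve k (P : {mpoly K[3]}) :
  P \is symmetric -> P \is (6 * k).-homog ->
  exists N, forall l, UU l -> Cayley_poly.@[coord l] = 0 ->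
    P.@[coord l] = esym3 (coord l) ^+ (2 * k) * N.[jinv (coord l)].
Proof.
move=> Ps Ph; have [t [<- th]] := sym_fundamental_homog Ps Ph.
exists (\sum_(m <- msupp t) (t@_m * 4%:R ^- m i0) *:
  'X^((2 * m i0 + m i1) %/ 3)) => l lU lC.
rewrite comp_mpoly_meval mevalE horner_sum mulr_sumr !big_seq.
apply: eq_bigr => m mt; have mw := dhomogP _ _ _ th m mt.
have {mt}mw : (m i0 + 2 * m i1 + 3 * m i2 = 6 * k)%N.
  rewrite -mw /= /mnmwgt big_ord3 !inordK // muln1.
  by rewrite [(m i1 * _)%N]mulnC [(m i2 * _)%N]mulnC.
rewrite hornerZ hornerXn -mulrA [RHS]mulrCA; congr (_ * _).
rewrite big_ord3 !tnth_mktuple !inordK // !meval_mesym /=.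
(* Doubling the weight relation gives [2 * m i0 + m i1 = 12 * k - 3 * m i1 - 6 * m i2]. *)
have [q Eq] : exists q, (2 * m i0 + m i1 = 3 * q)%N.
  by exists (4 * k - (2 * m i2 + m i1))%N; lia.
rewrite Eq mulKn //; move: lC; rewrite Cayley_polyE => /eqP.
rewrite subr_eq0 => /eqP lC.
rewrite (monomial_on_curve (esym3_neq0 lU) lC Eq (k := k)) 1?mulrCA //; lia.
Qed.

(** A form separating a point of the curve from [S], once symmetrized, is on the curve a power of
    [esym3] times a polynomial in [jmap]. It stays nonzero at the point and zero on [S], hence so
    does that polynomial. *)
Lemma closed_meet_curve S : closed_US3 S -> ~ Z `<=` S ->
  exists2 N, N != 0 & forall x, S x -> Z x -> N.[jmap x] = 0.
Proof.
move=> /closed_US3P[SU HS] /existsNP[_ /not_implyP[[l [lU lC ->]] Sl]].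
have [d [P [Pd Pl PS]]] := HS _ lU Sl.
have [k [e [R [Re edk RPl]]]] := symmetrization lU Pd Pl.
have RPh := dhomogM Re Pd; rewrite edk in RPh.
have Qh : \sum_(s : 'S_3) msym s (R * P) \is (6 * k).-homog.
  by apply: rpred_sum => s _; apply: dhomog_msym.
have [N NQ] := symmetric_on_curve (sum_msym_sym _) Qh.
exists N => [|x Sx [l' [l'U l'C E]]].
  by apply: contraNneq RPl => N0; rewrite NQ // N0 horner0 mulr0.
apply: (mulfI (expf_neq0 (2 * k) (esym3_neq0 l'U))).
rewrite E jmapE -NQ // mulr0 raddf_sum big1 // => s _.
have [l'0 l'inj] := l'U.
have [||l1 [a [l1U a0 _ El1]]] := @UU_exists K (coord l' \o s).
- by move=> i; apply: l'0.
- exact: inj_comp l'inj (@perm_inj _ s).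
rewrite /= meval_msym (meval_eq _ El1) (meval_homog _ _ RPh) mevalM.
have El' : qS3 l' = qS3 l1 by apply/qS3P; exists s, a.
by rewrite (PS l1) ?mulr0 // -El' -E.
Qed.

Lemma exists_curve_point N : N != 0 ->
  exists l, [/\ UU l, Cayley_poly.@[coord l] = 0 & N.[jinv (coord l)] != 0].
Proof.
(* The extra factor keeps [y] away from 54, the value excluded in [jinv_surj]. *)
move=> N0; have /closed_nonrootP[y] : N * ('X - 54%:R%:P) != 0.
  by rewrite mulf_neq0 // polyXsubC_eq0.
rewrite rootM root_XsubC negb_or => /andP[Ny /jinv_surj[l [lU lC lj]]].
by exists l; rewrite lj.
Qed.

(** Two closed sets not containing the curve meet it inside the zeros of nonzero polynomials in
    [jmap]; a point where the product of these is nonzero lies in neither set. *)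
Lemma irreducible_Cayley_curve : irreducible_US3 Z.
Proof.
split; first exact: closed_Cayley_curve.
  have [l [lU lC _]] := exists_curve_point (oner_neq0 _).
  by exists (qS3 l), l.
move=> A B Ac Bc ZAB; have [ZA|/(closed_meet_curve Ac)[N N0 NA]] := pselect (Z `<=` A).
  by left; apply/seteqP; split=> // x Ax; rewrite ZAB; left.
have [ZB|/(closed_meet_curve Bc)[M M0 MB]] := pselect (Z `<=` B).
  by right; apply/seteqP; split=> // x Bx; rewrite ZAB; right.
have [l [lU lC]] := exists_curve_point (mulf_neq0 N0 M0).
have Zl : Z (qS3 l) by exists l.
rewrite hornerM -jmapE; have := Zl; rewrite {1}ZAB => -[/NA|/MB] -> //.
  by rewrite mul0r eqxx.
by rewrite mulr0 eqxx.
Qed.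

Lemma irreducible_US3_point x : US3 x -> irreducible_US3 [set x].
Proof.
move=> [l lU <-]; split; [exact: closed_US3_point | by exists (qS3 l) |].
move=> A B _ _ E; have : (A `|` B) (qS3 l) by rewrite -E.
have HA : A `<=` [set qS3 l] by rewrite E => ?; left.
have HB : B `<=` [set qS3 l] by rewrite E => ?; right.
by case=> H; [left|right]; apply/seteqP; split=> // y ->.
Qed.

(** On a proper closed subset [jmap] takes finitely many values. Splitting them off one at a time,
    irreducibility leaves a single value, and [jmap] is injective. *)
Lemma irreducible_curve_subset S : irreducible_US3 S -> S `<=` Z -> S != Z ->
  exists x, S = [set x].
Proof.
move=> [Sc [x Sx] Sirr] SZ SnZ.
have [|N N0 NS] := closed_meet_curve Sc.
  by move=> ZS; case/eqP: SnZ; apply/seteqP.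
have [r Sr] : exists r, forall y, S y -> jmap y = r.
  have [rs EN] := closed_field_poly_normal N.
  have : forall y, S y -> jmap y \in rs.
    move=> y Sy; move/eqP: (NS y Sy (SZ y Sy)).
    rewrite EN hornerZ mulf_eq0 lead_coef_eq0 (negPf N0).
    by rewrite -[_ == 0]/(root _ _) root_prod_XsubC.
  elim: rs {EN} => [/(_ x Sx)//|r rs IH Hrs].
  pose W := jlocus (\prod_(z <- rs) ('X - z%:P)).
  have Wc : closed_US3 (S `&` W) by apply/closed_US3I/closed_jlocus.
  have Vc : closed_US3 (S `&` jlocus ('X - r%:P)) by apply/closed_US3I/closed_jlocus.
  have SU := (closed_US3P S).1 Sc.
  have [|E|E] := Sirr _ _ Vc Wc.
  - apply/seteqP; split=> [y Sy|y [[]|[]]//].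
    have := Hrs y Sy; rewrite inE => /orP[/eqP yr|yrs].
      by left; split=> //; split; [exact: SU.1 | rewrite hornerXsubC yr subrr].
    right; split=> //; split; first exact: SU.1.
    by apply/eqP; rewrite -[_ == 0]/(root _ _) root_prod_XsubC.
  - exists r => y; rewrite E => -[_ [_]].
    by rewrite hornerXsubC => /eqP; rewrite subr_eq0 => /eqP.
  - apply: IH => y; rewrite E => -[_ [_ /eqP]].
    by rewrite -[_ == 0]/(root _ _) root_prod_XsubC.
exists x; apply/seteqP; split=> y; last by move=> ->.
move=> Sy; apply: jmap_inj; by [exact/mem_set/SZ | rewrite !Sr].
Qed.

Lemma curve_local_dimension x : Z x -> local_dimension Z x 1.
Proof.
move=> Zx; have [l [lU lC xl]] := Zx.
have xU : US3 x by rewrite xl; apply/US3_qS3.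
split.
  exists (fun i => if i is 0 then [set x] else Z); split=> //.
  - case=> [|[|//]] _; [exact: irreducible_US3_point|exact: irreducible_Cayley_curve].
  - case=> // _; split=> [y ->//|Zs].
    have [|l' [l'U l'C]] := @exists_curve_point ('X - (jmap x)%:P).
      by rewrite polyXsubC_eq0.
    rewrite hornerXsubC subr_eq0 -jmapE => /eqP; apply; congr jmap.
    by apply: Zs; exists l'.
(* In a chain of length at least 2, [c 1] is irreducible and properly contained in the curve, hence
   a point; then the nonempty set [c 0] already equals it. *)
move=> n c [cirr cx cZ cS]; rewrite leqNgt; apply/negP => n1.
have cnZ i : (i <= n)%N -> c i `<=` Z.
  move=> /subnKC; move: (n - i)%N => m; elim: m i => [|m IH] i.
    by rewrite addn0 => ->.
  rewrite addnS -addSn => E; apply: subset_trans (IH _ E).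
  by have [] := cS i; rewrite // -E ltn_addr.
have [c12 nc21] := cS _ n1; have [c01 nc10] := cS _ (ltnW n1).
have [|||y c1y] := @irreducible_curve_subset (c 1%N).
- exact/cirr/ltnW.
- exact/cnZ/ltnW.
- by apply/eqP => E; apply: nc21; rewrite E; apply: cnZ.
apply: nc10; rewrite c1y => _ ->.
have [_ [z c0z] _] := cirr 0%N (leq0n _).
by have := c01 _ c0z; rewrite c1y => <-.
Qed.

End Curve.

(** * Regular germs on the curve and smoothness *)

Section Smoothness.
Variable K : numClosedFieldType.
Implicit Types (l : proj 'rV[K]_3) (x : P2_S3 K) (N : {poly K}).

Local Notation Z := (@Cayley_curve K).

Lemma regular_jfraction x N M : US3 x -> M.[jmap x] != 0 ->
  regular_at x (fun y => N.[jmap y] / M.[jmap y]).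
Proof.
move=> xU Mx; split=> // l lU lx; pose n := maxn (size N) (size M).
have sN : (size N <= n.+1)%N by rewrite leqW ?leq_maxl.
have sM : (size M <= n.+1)%N by rewrite leqW ?leq_maxr.
exists (6 * n)%N, (jhomog N n), (jhomog M n).
split; try exact: jhomog_homog.
  by rewrite jhomogE // mulf_neq0 ?expf_neq0 ?esym3_neq0 // -jmapE lx.
move=> l' l'U _; rewrite !jhomogE // jmapE -mulf_div divff ?mul1r //.
by rewrite expf_neq0 ?esym3_neq0.
Qed.

(** Write [g] as [P * Q / (Q * Q)] and symmetrize both parts after multiplication by the same [R].
    At every permuted point the numerator term is [g] times the denominator term, even where [Q]
    vanishes, since both contain [Q]. *)
Lemma regular_at_curve x g : Z x -> regular_at x g ->
  exists N M, M.[jmap x] != 0 /\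
    forall y, Z y -> N.[jmap y] = g y * M.[jmap y].
Proof.
move=> [l [lU lC xl]] [xU /(_ l lU (esym xl))[d [P [Q [Pd Qd Ql gPQ]]]]].
have QQl : (Q * Q).@[coord l] != 0 by rewrite mevalM mulf_neq0.
have [k [e [R [Re edk RQl]]]] := symmetrization lU (dhomogM Qd Qd) QQl.
have RQh := dhomogM Re (dhomogM Qd Qd); rewrite edk in RQh.
have RPh := dhomogM Re (dhomogM Pd Qd); rewrite edk in RPh.
have sumh (S : {mpoly K[3]}) : S \is (6 * k).-homog ->
    \sum_(s : 'S_3) msym s S \is (6 * k).-homog.
  by move=> Sh; apply: rpred_sum => s _; apply: dhomog_msym.
have [N NE] := symmetric_on_curve (sum_msym_sym (R * (P * Q))) (sumh _ RPh).
have [M ME] := symmetric_on_curve (sum_msym_sym _) (sumh _ RQh).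
exists N, M; split.
  by apply: contraNneq RQl; rewrite xl jmapE ME // => ->; rewrite mulr0.
move=> _ [l1 [l1U l1C ->]]; rewrite jmapE.
apply: (mulfI (expf_neq0 (2 * k) (esym3_neq0 l1U))).
rewrite -NE // [RHS]mulrCA -ME // !raddf_sum /= mulr_sumr; apply: eq_bigr => s _.
have [l10 l1inj] := l1U.
have [||l2 [a [l2U a0 _ El2]]] := @UU_exists K (coord l1 \o s).
- by move=> i; apply: l10.
- exact: inj_comp l1inj (@perm_inj _ s).
have -> : qS3 l1 = qS3 l2 by apply/qS3P; exists s, a.
rewrite !meval_msym !(meval_eq _ El2) (meval_homog _ _ RPh) (meval_homog _ _ RQh).
rewrite [RHS]mulrCA; congr (_ * _); rewrite !mevalM.
have [Q2|Q2] := eqVneq Q.@[coord l2] 0; first by rewrite Q2 !mulr0.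
by rewrite gPQ //; field.
Qed.

(** In [g = N / M] the numerator vanishes at [jmap x], so it is divisible by the generator; the
    quotient over [M] is regular at [x], and the zeros of [M] form the closed set to be removed. *)
Lemma curve_maximal_ideal x : Z x -> maximal_ideal_generated Z x 1.
Proof.
move=> Zx; have xU : US3 x by have [l [lU _ ->]] := Zx; apply/US3_qS3.
pose t (_ : 'I_1) y := ('X - (jmap x)%:P : {poly K}).[jmap y] / (1 : {poly K}).[jmap y].
exists t; split=> [i|g gr gx].
  split; first by apply: regular_jfraction => //; rewrite hornerC oner_neq0.
  by rewrite /t hornerXsubC subrr mul0r.
have [N [M [Mx NM]]] := regular_at_curve Zx gr.
have /factor_theorem[N' NE] : root N (jmap x) by rewrite /root NM // gx mul0r.
exists (fun _ y => N'.[jmap y] / M.[jmap y]); split=> [_|].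
  exact: regular_jfraction.
exists (jlocus M); split; first exact: closed_jlocus.
  by case=> _ /eqP; rewrite (negPf Mx).
move=> y Zy My; have {}My : M.[jmap y] != 0.
  apply: contra_notN My => /eqP My; split=> //.
  by have [l [lU _ ->]] := Zy; apply/US3_qS3.
rewrite big_ord1 /t hornerC divr1; apply: (mulIf My).
by rewrite -NM // NE hornerM mulrAC divfK.
Qed.

Lemma smooth_Cayley_curve : smooth_US3 Z.
Proof.
split=> [|x Zx]; first exact: closed_Cayley_curve.
by exists 1%N; [exact: curve_local_dimension|exact: curve_maximal_ideal].
Qed.

End Smoothness.

(** * Irreducibility *)

Section Irreducibility.
Variable K : numClosedFieldType.
Implicit Types (P A B : {mpoly K[3]}) (f : 'I_3 -> K) (x y z : K).

Lemma poly_ext (p q : {poly K}) : (forall x, p.[x] = q.[x]) -> p = q.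
Proof.
move=> E; apply/eqP; rewrite -subr_eq0; apply: contrapT => /negP.
by move=> /closed_nonrootP[x]; rewrite /root hornerD hornerN E subrr eqxx.
Qed.

(* Kronecker substitution: the monomials of [P] are sent to distinct powers. *)
Lemma mpoly_eval_eq0 P : (forall f, P.@[f] = 0) -> P = 0.
Proof.
move=> P0; pose b := msize P.
pose k (m : 'X_{1..3}) := (m i0 + b * (m i1 + b * m i2))%N.
have mb m i : m \in msupp P -> (m i < b)%N.
  by move=> /msize_mdeg_lt; apply: leq_trans; rewrite ltnS mdegE (bigD1 i) //= leq_addr.
have kinj : {in msupp P &, injective k}.
  move=> m m' mP m'P E.
  have digits a r a' r' : (a < b -> a' < b -> a + b * r = a' + b * r' ->
      a = a' /\ r = r')%N.
    move=> ab a'b H; have b0 : (0 < b)%N by apply: leq_ltn_trans ab.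
    have := congr1 (modn^~ b) H; have := congr1 (divn^~ b) H.
    rewrite /= !(addnC _ (b * _)%N) ![(b * _)%N]mulnC !divnMDl // !modnMDl.
    by rewrite !divn_small // !modn_small // !addn0.
  have [E0 E12] := digits _ _ _ _ (mb _ _ mP) (mb _ _ m'P) E.
  have [E1 E2] := digits _ _ _ _ (mb _ _ mP) (mb _ _ m'P) E12.
  by apply/mnmP; apply: ord3P.
pose p : {poly K} := \sum_(m <- msupp P) P@_m *: 'X^(k m).
have p0 : p = 0.
  apply: poly_ext => x; rewrite horner0 -[RHS](P0 (vec3 x (x ^+ b) (x ^+ (b * b)))).
  rewrite mevalE horner_sum; apply: eq_bigr => m _; rewrite hornerZ hornerXn.
  by rewrite big_ord3 !vec3E /= -!exprM -!exprD /k mulnDr mulnA addnA.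
apply/eqP; rewrite -msupp_eq0; case E: (msupp P) => [//|m s].
have mP : m \in msupp P by rewrite E mem_head.
have : p`_(k m) = 0 by rewrite p0 coef0.
rewrite coef_sum (bigD1_seq m) //= coefZ coefXn eqxx mulr1 big1_seq ?addr0.
  by move/eqP; rewrite mcoeff_eq0 mP.
move=> m' /andP[m'm m'P]; rewrite coefZ coefXn.
by rewrite (negPf (contra_neq (kinj _ _ mP m'P) _)) ?mulr0 // eq_sym.
Qed.

Lemma mpoly_ext P Q : (forall f, P.@[f] = Q.@[f]) -> P = Q.
Proof.
move=> E; apply/eqP; rewrite -subr_eq0; apply/eqP/mpoly_eval_eq0 => f.
by rewrite mevalB E subrr.
Qed.

(* [Cayley_poly] vanishes at the inverses of the squares of [b0, b1, b2] when
   [b0 + b1 + b2 = 0]. *)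
Definition vanishing P := forall b : 'I_3 -> K, (forall i, b i != 0) ->
  esym1 b = 0 -> P.@[fun i => b i ^- 2] = 0.

Lemma vanishing_factor A B : A * B = Cayley_poly -> vanishing A \/ vanishing B.
Proof.
pose s : {mpoly K[3]} := 'X_i0; pose u : {mpoly K[3]} := 'X_i1.
pose w : {mpoly K[3]} := 'X_i2.
(* These are [s ^- 2], [u ^- 2], [(s + u) ^- 2] times [w * (s * u * (s + u)) ^+ 2]: a polynomial
   parametrization of the curve with scale [w]. The value of [w] chosen below cancels the common
   denominator. *)
pose q := [tuple vec3 (w * u ^+ 2 * (s + u) ^+ 2) (w * s ^+ 2 * (s + u) ^+ 2)
                      (w * s ^+ 2 * u ^+ 2) i | i < 3].
have vanish P : P \mPo q = 0 -> vanishing P.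
  move=> P0 b b0 b1; have b01 : b i0 + b i1 = - b i2.
    by apply/eqP; rewrite -addr_eq0; apply/eqP.
  have := congr1 (meval (vec3 (b i0) (b i1) ((b i0 * b i1 * b i2) ^- 2))) P0.
  rewrite comp_mpoly_meval meval0 => <-; apply: meval_eq; apply: ord3P;
    rewrite tnth_mktuple !vec3E !(mevalM, mevalD, rmorphXn) /= !mevalXU !vec3E ?b01;
    by field; rewrite !b0.
move=> AB; suff : (A \mPo q) * (B \mPo q) == 0.
  by rewrite mulf_eq0 => /orP[]/eqP/vanish; [left|right].
rewrite -rmorphM /= AB; apply/eqP/mpoly_eval_eq0 => f.
rewrite comp_mpoly_meval Cayley_polyE /esym1 /esym2 /esym3 !tnth_mktuple !vec3E.
by rewrite !(mevalM, mevalD, rmorphXn) /=; ring.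
Qed.

(** For fixed [y] and [z], [Cayley_poly] is quadratic in the first variable, with leading
    coefficient [- (y - z) ^+ 2] and roots [(p + q) ^- 2] and [(p - q) ^- 2], where [p] and [q] are
    square roots of [y^-1] and [z^-1]. [A] takes both roots, which leaves a constant for [B]. *)
Lemma constant_in_first A B x x' y z : A * B = Cayley_poly -> vanishing A ->
  y != 0 -> z != 0 -> y != z -> B.@[vec3 x y z] = B.@[vec3 x' y z].
Proof.
move=> AB vA y0 z0 yz.
pose sub P : {poly K} := mmap polyC (vec3 'X y%:P z%:P) P.
have subE P t : (sub P).[t] = P.@[vec3 t y z].
  rewrite /sub mevalE /mmap horner_sum; apply: eq_bigr => m _.
  rewrite hornerM hornerC /mmap1 !big_ord3 !hornerM !horner_exp !vec3E.
  by rewrite hornerX !hornerC.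
pose p := sqrtC y^-1; pose q := sqrtC z^-1.
have yE : y = p ^- 2 by rewrite sqrtCK invrK.
have zE : z = q ^- 2 by rewrite sqrtCK invrK.
have p0 : p != 0 by rewrite sqrtC_eq0 invr_eq0.
have q0 : q != 0 by rewrite sqrtC_eq0 invr_eq0.
have [pq pq'] : p + q != 0 /\ p - q != 0.
  apply/andP; rewrite -negb_or -mulf_eq0; apply: contra_neqN yz => /eqP pq.
  rewrite yE zE; congr (_^-1); apply/eqP; rewrite -subr_eq0; apply/eqP.
  by rewrite -[RHS]pq; ring.
pose x1 := (p + q) ^- 2; pose x2 := (p - q) ^- 2; pose c := - (y - z) ^+ 2.
have c0 : c != 0 by rewrite oppr_eq0 expf_neq0 // subr_eq0.
have Ax1 : root (sub A) x1.
  have E : vec3 x1 y z =1 fun i => vec3 (- (p + q)) p q i ^- 2.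
    by apply: ord3P; rewrite !vec3E ?sqrrN.
  rewrite /root subE (meval_eq _ E) vA //.
    by apply: ord3P; rewrite vec3E ?oppr_eq0.
  by rewrite /esym1 !vec3E; ring.
have Ax2 : root (sub A) x2.
  have E : vec3 x2 y z =1 fun i => vec3 (- (p - q)) p (- q) i ^- 2.
    by apply: ord3P; rewrite !vec3E ?sqrrN.
  rewrite /root subE (meval_eq _ E) vA //.
    by apply: ord3P; rewrite vec3E ?oppr_eq0.
  by rewrite /esym1 !vec3E; ring.
have x12 : x1 != x2.
  apply/negP => /eqP/invr_inj/eqP; rewrite -subr_eq0; apply/negP.
  have -> : (p + q) ^+ 2 - (p - q) ^+ 2 = 4%:R * (p * q) by ring.
  by rewrite !mulf_neq0 // pnatr_eq0.
have [r Er] : exists r, sub A = r * (('X - x1%:P) * ('X - x2%:P)).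
  have /factor_theorem[r1 Er1] := Ax1; move: Ax2; rewrite Er1 rootM root_XsubC.
  rewrite [x2 == x1]eq_sym (negPf x12) orbF => /factor_theorem[r ->].
  by exists r; rewrite -mulrA [X in _ * X]mulrC.
have EF : sub A * sub B = c%:P * (('X - x1%:P) * ('X - x2%:P)).
  apply: poly_ext => t; rewrite hornerM !subE -mevalM AB Cayley_polyE.
  rewrite /esym1 /esym2 /esym3 !vec3E !hornerM hornerC !hornerXsubC.
  rewrite /c yE zE /x1 /x2; field.
  by rewrite p0 q0 pq pq'.
have : r * sub B = c%:P.
  apply: (@mulIf _ (('X - x1%:P) * ('X - x2%:P))).
    by rewrite mulf_neq0 ?polyXsubC_eq0.
  by rewrite -EF Er mulrAC.
move=> E; have : size (r * sub B) == 1%N by rewrite E size_polyC c0.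
rewrite size_mul_eq1 => /andP[_ /size_poly1P[d _ Ed]].
by rewrite -!subE Ed !hornerC.
Qed.

Lemma Cayley_poly_sym : (@Cayley_poly K) \is symmetric.
Proof.
apply/issymP => s; apply: mpoly_ext => f; rewrite meval_msym !Cayley_polyE.
by rewrite -[fun i => f (s i)]/(f \o s) !esym_perm.
Qed.

Lemma vanishing_msym s P : vanishing P -> vanishing (msym s P).
Proof.
move=> vP b b0 b1; rewrite meval_msym; apply: (vP (b \o s)) => [i|].
  exact: b0.
by rewrite esym_perm.
Qed.

(** By symmetry [B] ignores each coordinate while the other two are distinct and nonzero, so a
    generic point moves to [(1, 2, 3)] through [(1, y, z)] and [(1, 2, z)]. *)
Lemma cofactor_constant A B :
  A * B = Cayley_poly -> vanishing A -> B \is a GRing.unit.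
Proof.
move=> AB vA; have n0 n : n.+1%:R != 0 :> K by rewrite pnatr_eq0.
have step (s : 'S_3) f g x x' y z : y != 0 -> z != 0 -> y != z ->
    (fun i => vec3 x y z (s i)) =1 f -> (fun i => vec3 x' y z (s i)) =1 g ->
    B.@[f] = B.@[g].
  move=> y0 z0 yz fE gE; rewrite -(meval_eq _ fE) -(meval_eq _ gE) -!meval_msym.
  apply: (constant_in_first _ _ _ (vanishing_msym s vA) y0 z0 yz).
  by rewrite -msymM AB; apply/issymP/Cayley_poly_sym.
pose c := B.@[vec3 1 2%:R 3%:R].
have BE x y z : y != 0 -> z != 0 -> y != z -> z != 1 -> B.@[vec3 x y z] = c.
  move=> y0 z0 yz z1.
  have [i01 [i02 i12]] : i0 != i1 /\ i0 != i2 /\ i1 != i2.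
    by rewrite -!val_eqE /= !inordK.
  have t01 (u v w : K) : (fun i => vec3 u v w (tperm i0 i1 i)) =1 vec3 v u w.
    by apply: ord3P; rewrite ?tpermL ?tpermR ?tpermD ?vec3E.
  have t02 (u v w : K) : (fun i => vec3 u v w (tperm i0 i2 i)) =1 vec3 w v u.
    by apply: ord3P; rewrite ?tpermL ?tpermR ?tpermD ?vec3E // eq_sym.
  rewrite (constant_in_first x 1 AB vA y0 z0 yz).
  have := step _ _ _ y 2%:R 1 z _ _ _ (t01 _ _ _) (t01 _ _ _).
  rewrite oner_eq0 (eq_sym 1) => -> //.
  have := step _ _ _ z 3%:R 2%:R 1 _ _ _ (t02 _ _ _) (t02 _ _ _).
  by rewrite oner_eq0 pnatr_eq0 (eqr_nat _ 2 1) => ->.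
have BC : B = c%:MP.
  (* [D] vanishes wherever that path breaks down, so [(B - c) * D] vanishes everywhere and [D]
     cancels. *)
  pose D : {mpoly K[3]} := 'X_i1 * 'X_i2 * ('X_i1 - 'X_i2) * ('X_i2 - 1).
  have D0 : D != 0.
    apply/eqP => /(congr1 (meval (vec3 1 2%:R 3%:R))); apply/eqP; rewrite meval0.
    rewrite !(mevalM, mevalB, meval1) !mevalXU !vec3E.
    by rewrite (_ : _ * _ = - 12%:R) ?oppr_eq0 ?pnatr_eq0 //; ring.
  apply/eqP; rewrite -subr_eq0; apply/eqP/(mulIf D0); rewrite mul0r.
  apply: mpoly_eval_eq0 => f; rewrite !(mevalM, mevalB, meval1, mevalC) !mevalXU.
  have [->|f1] := eqVneq (f i1) 0; first by ring.
  have [->|f2] := eqVneq (f i2) 0; first by ring.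
  have [->|f12] := eqVneq (f i1) (f i2); first by ring.
  have [->|f21] := eqVneq (f i2) 1; first by ring.
  by rewrite (meval_eq _ (vec3_eta f)) BE //; ring.
have c0 : c != 0.
  apply/eqP => c0; move: AB; rewrite BC c0 mpolyC0 mulr0.
  move=> /(congr1 (meval (vec3 1 2%:R 3%:R))); rewrite meval0 Cayley_polyE.
  rewrite /esym1 /esym2 /esym3 !vec3E => /esym/eqP; apply/negP.
  rewrite (_ : _ - _ = 23%:R) ?pnatr_eq0 //; ring.
by rewrite BC; apply: rmorph_unit; rewrite unitfE.
Qed.

Lemma irreducible_Cayley_poly : irreducible_mpoly (@Cayley_poly K).
Proof.
split.
- apply/eqP => /(congr1 (meval (vec3 1 2%:R 3%:R))); rewrite meval0 Cayley_polyE.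
  rewrite /esym1 /esym2 /esym3 !vec3E => /eqP; apply/negP.
  rewrite (_ : _ - _ = 23%:R) ?pnatr_eq0 //; ring.
- apply/negP => /mulrV/(congr1 (meval (fun=> 0))).
  rewrite mevalM meval1 Cayley_polyE /esym1 /esym2 /esym3.
  rewrite (_ : _ - _ = 0) ?mul0r; last by ring.
  by move/esym/eqP; rewrite oner_eq0.
- move=> A B /esym AB; have [vA|vB] := vanishing_factor AB.
    by right; apply: cofactor_constant vA.
  by left; apply: (@cofactor_constant B); rewrite // mulrC.
Qed.

End Irreducibility.

(** * Pencils of conics *)

Section Pencils.
Variable K : numClosedFieldType.
Implicit Types (M N A : 'M[K]_3) (p : {poly K}).

Local Notation point := (proj 'cV[K]_3).
Local Notation conics := (proj 'M[K]_3).
Implicit Types (C D : conics) (CD : conics * conics).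

Definition matrix_pencil M N : {poly K} :=
  \det ('X *: map_mx polyC M + map_mx polyC N).

Lemma horner_matrix_pencil M N t : (matrix_pencil M N).[t] = \det (t *: M + N).
Proof.
rewrite -[LHS]/(horner_eval t _) -det_map_mx; congr (\det _).
by apply/matrixP => i j; rewrite !mxE /= /horner_eval hornerD hornerM hornerX !hornerC.
Qed.

Lemma coef_matrix_pencil0 M N : (matrix_pencil M N)`_0 = \det N.
Proof. by rewrite -horner_coef0 horner_matrix_pencil scale0r add0r. Qed.

Lemma matrix_pencil_scale M N a b : b != 0 -> exists c k, [/\ c = b ^+ 3, k = a / b &
  forall i, (matrix_pencil (a *: M) (b *: N))`_i = c * k ^+ i * (matrix_pencil M N)`_i].
Proof.
move=> b0; exists (b ^+ 3), (a / b); split=> // i; set p := matrix_pencil M N.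
have -> : matrix_pencil (a *: M) (b *: N) =
    \poly_(j < size p) (b ^+ 3 * (a / b) ^+ j * p`_j).
  apply: poly_ext => t; rewrite horner_poly horner_matrix_pencil.
  have -> : t *: (a *: M) + b *: N = b *: ((a / b * t) *: M + N).
    by rewrite scalerDr !scalerA mulrA [b * _]mulrC divfK // mulrC.
  rewrite detZ -horner_matrix_pencil horner_coef mulr_sumr.
  by apply: eq_bigr => j _; rewrite exprMn; ring.
by rewrite coef_poly; case: ltnP => // /(nth_default 0) ->; rewrite mulr0.
Qed.

Lemma matrix_pencil_congr M N A :
  matrix_pencil (A^T *m M *m A) (A^T *m N *m A) = (\det A ^+ 2) *: matrix_pencil M N.
Proof.
apply: poly_ext => t; rewrite hornerZ !horner_matrix_pencil.
have -> : t *: (A^T *m M *m A) + A^T *m N *m A = A^T *m (t *: M + N) *m A.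
  by rewrite mulmxDr mulmxDl -scalemxAr -scalemxAl.
by rewrite !det_mulmx det_tr; ring.
Qed.

Lemma represents_repE (V : lmodType K) (v : V) x : represents v x ->
  exists2 a, a != 0 & rep x = a *: v.
Proof.
case=> a a0 ->; exists a^-1; first by rewrite invr_eq0.
by rewrite scalerA mulVf // scale1r.
Qed.

Lemma pencil_represents M N C D : represents M C -> represents N D ->
  exists c k, [/\ c != 0, k != 0 &
    forall i, (pencil (C, D))`_i = c * k ^+ i * (matrix_pencil M N)`_i].
Proof.
move=> /represents_repE[a a0 E] /represents_repE[b b0 E'].
have [c [k [cE kE Ec]]] := matrix_pencil_scale M N a b0.
exists c, k; split; first by rewrite cE expf_neq0.
  by rewrite kE mulf_neq0 ?invr_eq0.
by move=> i; rewrite -Ec /pencil /= E E'.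
Qed.

Lemma pencil_orbit CD CD' : G_orbit CD CD' -> exists c k, [/\ c != 0, k != 0 &
  forall i, (pencil CD')`_i = c * k ^+ i * (pencil CD)`_i].
Proof.
move=> /G_orbitP[A [Au A1 A2]].
have [c [k [c0 k0 E]]] := pencil_represents A1 A2.
exists (c * \det A ^+ 2), k; split=> //.
  by rewrite mulf_neq0 ?expf_neq0 // -unitfE -unitmxE.
move=> i; case: CD' A1 A2 E => C' D' A1 A2 ->.
rewrite matrix_pencil_congr coefZ -[matrix_pencil _ _]/(pencil CD); ring.
Qed.

Lemma on_conicE (v : 'cV[K]_3) M x C : represents v x -> represents M C ->
  on_conic x C <-> v^T *m M *m v = 0.
Proof.
move=> [a a0 ->] [b b0 ->]; rewrite /on_conic.
have -> : (a *: rep x)^T *m (b *: rep C) *m (a *: rep x) =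
    (a * b * a) *: ((rep x)^T *m rep C *m rep x).
  rewrite [(_ *: rep x)^T]linearZ /= -!scalemxAl -!scalemxAr -scalemxAl !scalerA.
  by congr (_ *: _); ring.
split=> [->|/eqP]; first by rewrite scaler0.
by rewrite scaler_eq0 !mulf_eq0 !(negPf a0, negPf b0) => /eqP.
Qed.

Lemma conic_represents M C : represents M C -> conic C <-> M^T = M.
Proof.
move=> [a a0 ->]; rewrite /conic [(_ *: _)^T]linearZ /=; split=> [->//|/scalerI].
by apply.
Qed.

Lemma nondegenerate_represents M C : represents M C ->
  nondegenerate C <-> M \in unitmx.
Proof.
move=> [a a0 ->]; rewrite /nondegenerate !unitmxE detZ unitrMr //.
by rewrite unitfE expf_neq0.
Qed.

(** [A] induces a bijection [f] of the plane with inverse [g]. A point lies on the transformed conic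
    exactly when its image under [f] lies on the original one, so [g] carries the four common
    points. *)
Lemma transverse_orbit CD CD' : G_orbit CD CD' ->
  transverse CD.1 CD.2 -> transverse CD'.1 CD'.2.
Proof.
move=> /G_orbitP[A [Au A1 A2]] [s [su s4 sP]].
have image (B : 'M[K]_3) : B \in unitmx ->
    exists f : point -> point, forall x, represents (B *m rep x) (f x).
  move=> Bu; suff /choice[f fP] : forall x : point, exists y, represents (B *m rep x) y.
    by exists f.
  move=> x; apply: represents_exists.
  apply: contra_neq (rep_neq0 x) => Bx.
  by rewrite -[rep x](mulKmx Bu) Bx mulmx0.
have [f fP] := image _ Au.
have [g gP] : exists g : point -> point, forall x, represents (invmx A *m rep x) (g x).
  by apply: image; rewrite unitmx_inv.
have cancels B B' (h h' : point -> point) : B *m B' = 1%:M ->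
    (forall x, represents (B *m rep x) (h x)) ->
    (forall x, represents (B' *m rep x) (h' x)) -> cancel h' h.
  move=> BB' hP h'P x; have [a a0 E] := represents_repE (h'P x).
  apply: represents_inj (hP _) _.
  rewrite E -scalemxAr mulmxA BB' mul1mx.
  exact: representsZ (represents_rep _).
have gK : cancel g f := cancels _ _ _ _ (mulmxV Au) fP gP.
have fK : cancel f g := cancels _ _ _ _ (mulVmx Au) gP fP.
exists (map g s); split; rewrite ?size_map ?(map_inj_uniq (can_inj gK)) // => x.
have on M C C' : represents (A^T *m M *m A) C' -> represents M C ->
    on_conic x C' <-> on_conic (f x) C.
  move=> MC' MC; rewrite (on_conicE (represents_rep x) MC') (on_conicE (fP x) MC).
  by rewrite trmx_mul !mulmxA.
rewrite (on _ _ _ A1 (represents_rep _)) (on _ _ _ A2 (represents_rep _)) -sP.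
by rewrite -{1}(fK x) (mem_map (can_inj gK)).
Qed.

Lemma OO_orbit CD CD' : G_orbit CD CD' -> OO CD -> OO CD'.
Proof.
move=> CDo [C1 C2 C3 C4 C5]; have [A [Au A1 A2]] := (G_orbitP _ _).1 CDo.
have sym M : M^T = M -> (A^T *m M *m A)^T = A^T *m M *m A.
  by move=> E; rewrite !trmx_mul trmxK E mulmxA.
split.
- exact/(conic_represents A1)/sym.
- exact/(conic_represents A2)/sym.
- by apply/(nondegenerate_represents A1); rewrite !unitmx_mul unitmx_tr Au C3.
- by apply/(nondegenerate_represents A2); rewrite !unitmx_mul unitmx_tr Au C4.
- exact: transverse_orbit C5.
Qed.

(** * Taylor coefficients of the square root of a polynomial *)

Section SquareRoot.
Variables (p : {poly K}) (r : K).

(** For positive [n], coefficient [n] of the square is [2 * r * A n] plus products of earlier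
    coefficients, and is solved for [A n]; a list is built because each step uses all earlier
    values. *)
Fixpoint sqrt_coefs n : seq K :=
  if n is m.+1 then
    let s := sqrt_coefs m in
    rcons s ((p`_n - \sum_(i < m) s`_i.+1 * s`_(m - i)) / (2%:R * r))
  else [:: r].

Lemma size_sqrt_coefs n : size (sqrt_coefs n) = n.+1.
Proof. by elim: n => //= n IH; rewrite size_rcons IH. Qed.

Lemma nth_sqrt_coefs n i : (i <= n)%N -> (sqrt_coefs n)`_i = (sqrt_coefs i)`_i.
Proof.
elim: n => [|n IH]; first by rewrite leqn0 => /eqP ->.
rewrite leq_eqVlt => /orP[/eqP ->//|]; rewrite ltnS => lin.
by rewrite /= nth_rcons size_sqrt_coefs ltnS lin IH.
Qed.

Lemma sqrt_series_exists : r != 0 -> r ^+ 2 = p`_0 ->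
  sqrt_series p (fun n => (sqrt_coefs n)`_n).
Proof.
move=> r0 rp [|n]; first by rewrite big_ord1 /= -rp.
rewrite big_ord_recl big_ord_recr subn0 subnn.
set a := (sqrt_coefs n.+1)`_n.+1.
have aE : a * (2%:R * r) =
    p`_n.+1 - \sum_(i < n) (sqrt_coefs n)`_i.+1 * (sqrt_coefs n)`_(n - i).
  rewrite /a /= nth_rcons size_sqrt_coefs ltnn eqxx divfK //.
  by rewrite mulf_neq0 // pnatr_eq0.
rewrite (_ : (sqrt_coefs _)`_(ord0 : 'I__) = r) //.
rewrite (eq_bigr (fun i : 'I_n => (sqrt_coefs n)`_i.+1 * (sqrt_coefs n)`_(n - i))).
  have -> : p`_n.+1 = a * (2%:R * r) +
      \sum_(i < n) (sqrt_coefs n)`_i.+1 * (sqrt_coefs n)`_(n - i).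
    by rewrite aE subrK.
  rewrite /= -/a; ring.
move=> i _; rewrite /bump /= !(nth_sqrt_coefs (n := n)) ?leq_subr //.
Qed.

End SquareRoot.

Lemma CayleyP CD : Cayley K CD <->
  OO CD /\ 4%:R * (pencil CD)`_0 * (pencil CD)`_2 = (pencil CD)`_1 ^+ 2.
Proof.
split=> [[CDO [A AP A2]]|[CDO H]]; split=> //.
  have := AP 0%N; have := AP 1%N; have := AP 2%N.
  rewrite !big_ord_recl !big_ord0 /= !subn0 !addr0 A2 !(mulr0, mul0r, add0r).
  by move=> <- <- <-; rewrite /bump /=; ring.
have p0 : (pencil CD)`_0 != 0.
  rewrite -[pencil _]/(matrix_pencil _ _) coef_matrix_pencil0 -unitfE -unitmxE.
  by case: CDO.
pose r := sqrtC (pencil CD)`_0.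
have r0 : r != 0 by rewrite sqrtC_eq0.
have rp : r ^+ 2 = (pencil CD)`_0 by rewrite sqrtCK.
have [A AP A0] : exists2 A, sqrt_series (pencil CD) A & A 0%N = r.
  by eexists; first exact: sqrt_series_exists r0 rp.
exists A => //.
have E1 : r * A 1%N + A 1%N * r = (pencil CD)`_1.
  by rewrite -A0 -(AP 1%N) big_ord_recl big_ord1.
have E2 : r * A 2%N + (A 1%N * A 1%N + A 2%N * r) = (pencil CD)`_2.
  by rewrite -A0 -(AP 2%N) !big_ord_recl big_ord0 addr0.
(* From [p0 = r ^+ 2], [p1 = 2 * r * A1] and [p2 = 2 * r * A2 + A1 ^+ 2] follows
   [8 * r ^+ 3 * A2 = 4 * p0 * p2 - p1 ^+ 2]. *)
have r3 : 8%:R * r ^+ 3 != 0 by rewrite mulf_neq0 ?expf_neq0 // pnatr_eq0.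
apply: (mulfI r3); rewrite mulr0; apply/eqP.
have -> : 8%:R * r ^+ 3 * A 2%N =
    4%:R * r ^+ 2 * (r * A 2%N + (A 1%N * A 1%N + A 2%N * r))
    - (r * A 1%N + A 1%N * r) ^+ 2 by ring.
by rewrite E1 E2 rp H subrr.
Qed.

Lemma Cayley_orbit CD CD' : G_orbit CD CD' -> Cayley K CD -> Cayley K CD'.
Proof.
move=> CDo /CayleyP[CDO H]; apply/CayleyP; split; first exact: OO_orbit CDo CDO.
have [c [k [_ _ E]]] := pencil_orbit CDo; rewrite !E.
transitivity (c ^+ 2 * k ^+ 2 * (4%:R * (pencil CD)`_0 * (pencil CD)`_2)).
  by ring.
by rewrite H; ring.
Qed.

End Pencils.

Lemma det_mx3 (K : comNzRingType) (M : 'M[K]_3) : \det M =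
  M i0 i0 * (M i1 i1 * M i2 i2 - M i1 i2 * M i2 i1) -
  M i0 i1 * (M i1 i0 * M i2 i2 - M i1 i2 * M i2 i0) +
  M i0 i2 * (M i1 i0 * M i2 i1 - M i1 i1 * M i2 i0).
Proof.
have det2 (N : 'M[K]_2) : \det N = N ord0 ord0 * N ord_max ord_max -
    N ord0 ord_max * N ord_max ord0.
  rewrite (expand_det_row _ ord0) !big_ord_recl big_ord0 /cofactor !det_mx11 !mxE /=.
  rewrite addr0 expr0 mul1r expr1 mulN1r mulrN.
  by congr (N _ _ * N _ _ - N _ _ * N _ _); apply: val_inj.
rewrite (expand_det_row _ i0) big_ord3 /cofactor !det2 !mxE.
have L (i j : 'I_3) (k : 'I_2) : val j = bump i k -> lift i k = j.
  by move=> E; apply: val_inj.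
rewrite !(L i0 i1 ord0) ?(L i0 i2 ord_max) ?(L i1 i0 ord0) ?(L i1 i2 ord_max)
  ?(L i2 i0 ord0) ?(L i2 i1 ord_max);
  rewrite /= ?inordK //.
by rewrite expr0 expr1 sqrrN expr1n; ring.
Qed.

(* The next lemmas are stated for an abstract type because the same rewriting
   is very slow on quotient types. *)
Lemma vec3_ind (T : Type) (P : T -> Prop) (a b c : T) :
  P a -> P b -> P c -> forall i, P (vec3 a b c i).
Proof. by move=> Pa Pb Pc; apply: ord3P; rewrite vec3E. Qed.

Lemma vec3_inj (T : eqType) (a b c : T) :
  a != b -> a != c -> b != c -> injective (vec3 a b c).
Proof. by move=> ab ac bc; apply: ord3_inj; rewrite !vec3E. Qed.

Lemma mem_seq4 (T : eqType) (x a b c d : T) :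
  x = a \/ x = b \/ x = c \/ x = d -> x \in [:: a; b; c; d].
Proof. by case=> [->|[->|[->|->]]]; rewrite !inE eqxx ?orbT. Qed.

Lemma uniq_seq4 (T : eqType) (a b c d : T) : uniq [:: a; b; c; d] ->
  [/\ a != b, a != c & b != c] /\ [/\ d != a, d != b & d != c].
Proof.
rewrite /= !inE !negb_or !andbT -!andbA => /and5P[ab ac ad bc /andP[bd cd]].
by rewrite ![d == _]eq_sym.
Qed.

(** * Normal form of a pair of transverse conics *)

Section NormalForm.
Variable K : numClosedFieldType.
Implicit Types (f g : 'I_3 -> K) (u v : 'cV[K]_3) (M : 'M[K]_3).

Local Notation point := (proj 'cV[K]_3).
Local Notation conics := (proj 'M[K]_3).
Implicit Types (C D : conics).

(* The conics through the three coordinate points. *)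
Definition zdiag f : 'M[K]_3 := \matrix_(i, j)
  vec3 (vec3 0 (f i2) (f i1)) (vec3 (f i2) 0 (f i0)) (vec3 (f i1) (f i0) 0) i j.

Lemma det_zdiag f : \det (zdiag f) = 2%:R * (f i0 * f i1 * f i2).
Proof. by rewrite det_mx3 !mxE !vec3E; ring. Qed.

Lemma zdiag_sym f : (zdiag f)^T = zdiag f.
Proof. by apply/matrixP; apply: ord3P; apply: ord3P; rewrite !mxE !vec3E. Qed.

Lemma zdiagD t f g : t *: zdiag f + zdiag g = zdiag (fun i => t * f i + g i).
Proof.
by apply/matrixP; apply: ord3P; apply: ord3P; rewrite !mxE !vec3E; ring.
Qed.

Definition form M u v : K := (u^T *m M *m v) 0 0.

Lemma formE M u v : (u^T *m M *m v == 0) = (form M u v == 0).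
Proof.
apply/eqP/eqP => [E|E]; first by rewrite /form E mxE.
by apply/matrixP => i j; rewrite !ord1 [LHS]E mxE.
Qed.

Lemma form_zdiag f v : form (zdiag f) v v =
  2%:R * (f i0 * v i1 0 * v i2 0 + f i1 * v i0 0 * v i2 0 + f i2 * v i0 0 * v i1 0).
Proof.
rewrite /form !mxE !big_ord3 !mxE !big_ord3 !mxE !vec3E /=; ring.
Qed.

Lemma matrix_pencil_zdiag f g : (forall i, f i != 0) ->
  matrix_pencil (zdiag f) (zdiag g) =
    (2%:R * (f i0 * f i1 * f i2)) *: \prod_(i < 3) ('X - (- g i / f i)%:P).
Proof.
move=> f0; apply: poly_ext => t; rewrite horner_matrix_pencil zdiagD det_zdiag.
rewrite hornerZ big_ord3 /= !hornerM !hornerXsubC; field.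
by rewrite !f0.
Qed.

Lemma represents_neq u v (x y : point) i j : represents u x -> represents v y ->
  u i 0 * v j 0 != u j 0 * v i 0 -> x != y.
Proof.
move=> [a a0 ->] [b b0 ->]; rewrite !mxE; apply: contraNneq => ->; apply/eqP; ring.
Qed.

(** The equations are linear in the three pairwise products of coordinates, and independent because
    the [g i] are distinct. As [(1, 1, 1)] is a solution, every solution is a multiple of it. *)
Lemma zdiag_common_points f g (v : 'cV[K]_3) : (forall i, f i != 0) ->
  injective g -> esym1 f = 0 -> esym1 (fun i => g i * f i) = 0 ->
  form (zdiag f) v v = 0 -> form (zdiag (fun i => g i * f i)) v v = 0 ->
  v i1 0 * v i2 0 = v i0 0 * v i2 0 /\ v i0 0 * v i2 0 = v i0 0 * v i1 0.
Proof.
move=> f0 ginj; rewrite /esym1 => sf sg; rewrite !form_zdiag.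
have n2 : 2%:R != 0 :> K by rewrite pnatr_eq0.
move=> /eqP; rewrite mulf_eq0 (negPf n2) /= => /eqP Ef.
move=> /eqP; rewrite mulf_eq0 (negPf n2) /= => /eqP Eg.
have gn (i j : 'I_3) : i != j -> g i - g j != 0.
  by rewrite subr_eq0; apply: contra_neq => /ginj.
have [i01 [i02 i12]] : i0 != i1 /\ i0 != i2 /\ i1 != i2.
  by rewrite -!val_eqE /= !inordK.
have H (P Q R : K) : f i0 * P + f i1 * Q + f i2 * R = 0 ->
    g i0 * f i0 * P + g i1 * f i1 * Q + g i2 * f i2 * R = 0 -> P = Q /\ Q = R.
  move=> E1 E2; split; apply/eqP; rewrite -subr_eq0.
    apply/eqP; apply: (mulfI (mulf_neq0 (gn i2 i0 _) (f0 i0))); first by rewrite eq_sym.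
    rewrite mulr0; transitivity ((g i2 * (f i0 * P + f i1 * Q + f i2 * R) -
      (g i0 * f i0 * P + g i1 * f i1 * Q + g i2 * f i2 * R)) -
      Q * (g i2 * (f i0 + f i1 + f i2) - (g i0 * f i0 + g i1 * f i1 + g i2 * f i2))).
      by ring.
    by rewrite E1 E2 sf sg; ring.
  apply/eqP; apply: (mulfI (mulf_neq0 (gn i0 i1 i01) (f0 i1))).
  rewrite mulr0; transitivity ((g i0 * (f i0 * P + f i1 * Q + f i2 * R) -
    (g i0 * f i0 * P + g i1 * f i1 * Q + g i2 * f i2 * R)) -
    R * (g i0 * (f i0 + f i1 + f i2) - (g i0 * f i0 + g i1 * f i1 + g i2 * f i2))).
    by ring.
  by rewrite E1 E2 sf sg; ring.
by apply: H; rewrite !mulrA.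
Qed.

Definition col3 (x y z : K) : 'cV[K]_3 := \col_i vec3 x y z i.

Lemma form_zdiag_col3 f x y z : form (zdiag f) (col3 x y z) (col3 x y z) =
  2%:R * (f i0 * y * z + f i1 * x * z + f i2 * x * y).
Proof. by rewrite form_zdiag !mxE !vec3E. Qed.

(** Zero diagonals put the coordinate points on both conics and the vanishing sums put [[1 : 1 : 1]]
    there; [zdiag_common_points] excludes any other point. *)
Lemma OO_zdiag f g C D : (forall i, f i != 0) -> (forall i, g i != 0) ->
  injective g -> esym1 f = 0 -> esym1 (fun i => g i * f i) = 0 ->
  represents (zdiag f) C -> represents (zdiag (fun i => g i * f i)) D -> OO (C, D).
Proof.
move=> f0 g0 ginj sf sg fC gD.
have n2 : 2%:R != 0 :> K by rewrite pnatr_eq0.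
split=> /=.
- exact/(conic_represents fC)/zdiag_sym.
- exact/(conic_represents gD)/zdiag_sym.
- by apply/(nondegenerate_represents fC); rewrite unitmxE det_zdiag unitfE !mulf_neq0.
- by apply/(nondegenerate_represents gD); rewrite unitmxE det_zdiag unitfE !mulf_neq0.
have pt x y z : (x != 0) || (y != 0) || (z != 0) ->
    exists p : point, represents (col3 x y z) p.
  move=> nz; apply: represents_exists; apply: contraTneq nz => /colP E.
  have := E i0; have := E i1; have := E i2; rewrite !mxE !vec3E => -> -> ->.
  by rewrite eqxx.
have [|p0 P0] := pt 1 0 0; first by rewrite oner_neq0.
have [|p1 P1] := pt 0 1 0; first by rewrite oner_neq0 orbT.
have [|p2 P2] := pt 0 0 1; first by rewrite oner_neq0 !orbT.
have [|p3 P3] := pt 1 1 1; first by rewrite oner_neq0.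
exists [:: p0; p1; p2; p3]; split=> //.
  rewrite /= !inE !negb_or !andbT -!andbA.
  apply/and5P; split; last apply/andP; last split.
  - by apply: (represents_neq (i := i0) (j := i1) P0 P1);
      rewrite !mxE !vec3E !(mulr0, mul0r, mulr1) oner_neq0.
  - by apply: (represents_neq (i := i0) (j := i2) P0 P2);
      rewrite !mxE !vec3E !(mulr0, mul0r, mulr1) oner_neq0.
  - by apply: (represents_neq (i := i0) (j := i1) P0 P3);
      rewrite !mxE !vec3E !(mulr0, mul0r, mulr1) oner_neq0.
  - by apply: (represents_neq (i := i1) (j := i2) P1 P2);
      rewrite !mxE !vec3E !(mulr0, mul0r, mulr1) oner_neq0.
  - by apply: (represents_neq (i := i1) (j := i2) P1 P3);
      rewrite !mxE !vec3E !(mulr0, mul0r, mulr1) oner_neq0.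
  - by apply: (represents_neq (i := i2) (j := i1) P2 P3);
      rewrite !mxE !vec3E !(mulr0, mul0r, mulr1) oner_neq0.
have onE (v : 'cV[K]_3) p : represents v p -> (on_conic p C /\ on_conic p D) <->
    form (zdiag f) v v = 0 /\ form (zdiag (fun i => g i * f i)) v v = 0.
  move=> vp; rewrite (on_conicE vp fC) (on_conicE vp gD).
  have E M : v^T *m M *m v = 0 <-> form M v v = 0.
    by split=> /eqP E; apply/eqP; [rewrite -formE | rewrite formE].
  by rewrite !E.
move=> p; split.
  rewrite !inE => /or4P[] /eqP ->; [apply/(onE _ _ P0)|apply/(onE _ _ P1)|
    apply/(onE _ _ P2)|apply/(onE _ _ P3)]; rewrite !form_zdiag_col3.
  1-3: by split; ring.
  by rewrite !mulr1 -/(esym1 f) -/(esym1 (fun i => g i * f i)) sf sg mulr0.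
move=> /(onE _ _ (represents_rep p))[Ef Eg].
(* The pairwise products are equal: either two coordinates vanish or all three agree. *)
have [E1 E2] := zdiag_common_points f0 ginj sf sg Ef Eg.
move: E1 E2; set a := rep p i0 0; set b := rep p i1 0; set c := rep p i2 0 => E1 E2.
have pE x y z d q : represents (col3 x y z) q -> a = d * x -> b = d * y ->
    c = d * z -> p = q.
  move=> qr ax by' cz; have pd : rep p = d *: col3 x y z.
    by apply/matrixP => i j; rewrite !ord1 !mxE; move: i; apply: ord3P; rewrite vec3E.
  apply: represents_inj (represents_rep p) _; rewrite pd.
  apply: representsZ qr; apply: contra_neq (rep_neq0 p) => d0.
  by rewrite pd d0 scale0r.
apply: mem_seq4.
have [a0|a0] := eqVneq a 0.
  have /eqP : b * c = 0 by rewrite E1 a0 mul0r.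
  rewrite mulf_eq0 => /orP[]/eqP bc; [right; right; left | right; left].
    by apply: (pE _ _ _ c _ P2); rewrite ?mulr0 ?mulr1.
  by apply: (pE _ _ _ b _ P1); rewrite ?mulr0 ?mulr1.
have cb := mulfI a0 E2.
have [b0|b0] := eqVneq b 0.
  by left; apply: (pE _ _ _ a _ P0); rewrite ?mulr0 ?mulr1 // cb.
have cn0 : c != 0 by rewrite cb.
have ba := mulIf cn0 E1.
by right; right; right; apply: (pE _ _ _ a _ P3); rewrite mulr1 // cb.
Qed.

Lemma collinear_points (x y : point) a b :
  a *: rep x + b *: rep y = 0 -> x != y -> a = 0 /\ b = 0.
Proof.
move=> /eqP; rewrite addr_eq0 -scaleNr => /eqP E xy.
have [a0|a0] := eqVneq a 0; last first.
  case/eqP: xy; apply: represents_inj (represents_rep x) _.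
  have -> : rep x = (a^-1 * - b) *: rep y.
    by rewrite -scalerA -E scalerA mulVf // scale1r.
  apply: representsZ (represents_rep y); rewrite mulf_neq0 ?invr_eq0 //.
  apply: contra_eqN E => /eqP ->.
  by rewrite scale0r scaler_eq0 negb_or a0 rep_neq0.
split=> //; apply/eqP; have := rep_neq0 y; apply: contraNT => b0.
by move/eqP: E; rewrite a0 scale0r eq_sym scaler_eq0 oppr_eq0 (negPf b0).
Qed.

(** A plane is too large to be totally isotropic: with [L] of rank 2, the rank of [L^T *m M *m L] is
    at least [2 + 2 - 3]. *)
Lemma isotropic_plane M u v : M \in unitmx ->
  (forall a b, a *: u + b *: v = 0 -> a = 0 /\ b = 0) ->
  form M u u = 0 -> form M u v = 0 -> form M v u = 0 -> form M v v = 0 -> False.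
Proof.
move=> Mu uv; have E (w t : 'cV[K]_3) : form M w t = 0 -> w^T *m M *m t = 0.
  by move=> wt; apply/eqP; rewrite formE wt.
move=> /E uu /E uv0 /E vu /E vv; pose L := row_mx u v.
have L0 : L^T *m M *m L = 0.
  by rewrite tr_row_mx mul_col_mx mul_col_row uu uv0 vu vv block_mx0.
have Lfree : row_free L^T.
  apply: inj_row_free => w; rewrite -[w]hsubmxK tr_row_mx mul_row_col.
  rewrite [lsubmx w]mx11_scalar [rsubmx w]mx11_scalar !mul_scalar_mx => /(congr1 trmx).
  rewrite linearD !linearZ /= !trmxK trmx0 => /uv[-> ->].
  by rewrite !raddf0 row_mx0.
have := mxrank_mul_min (L^T *m M) L.
rewrite L0 mxrank0 mxrankMfree ?row_free_unit // -[\rank L]mxrank_tr.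
by move/eqP: Lfree => ->.
Qed.

Definition columns (V : 'I_3 -> 'cV[K]_3) : 'M[K]_3 := \matrix_(i, j) V j i 0.

Lemma mul_columns V (w : 'cV[K]_3) : columns V *m w = \sum_j w j 0 *: V j.
Proof.
apply/matrixP => i j; rewrite !mxE summxE; apply: eq_bigr => k _.
by rewrite !mxE !ord1 mulrC.
Qed.

Lemma columns_form M V i j :
  ((columns V)^T *m M *m columns V) i j = form M (V i) (V j).
Proof.
rewrite /form !mxE; apply: eq_bigr => k _; rewrite !mxE; congr (_ * _).
by apply: eq_bigr => l _; rewrite !mxE.
Qed.

Lemma columns_zdiag M V : M^T = M -> (forall i, form M (V i) (V i) = 0) ->
  exists f, (columns V)^T *m M *m columns V = zdiag f.
Proof.
move=> Ms V0; pose N := (columns V)^T *m M *m columns V.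
have Ns i j : N i j = N j i.
  by rewrite -[N in LHS]trmxK mxE /N !trmx_mul trmxK Ms mulmxA.
have N0 i : N i i = 0 by rewrite columns_form.
exists (vec3 (N i1 i2) (N i0 i2) (N i0 i1)); rewrite -/N.
by apply/matrixP; apply: ord3P; apply: ord3P; rewrite [RHS]mxE !vec3E ?N0 // Ns.
Qed.

Lemma formDr M u v w : form M u (v + w) = form M u v + form M u w.
Proof. by rewrite /form mulmxDr mxE. Qed.

Lemma formZr M u a v : form M u (a *: v) = a * form M u v.
Proof. by rewrite /form -scalemxAr mxE. Qed.

Lemma formC M u v : M^T = M -> form M u v = form M v u.
Proof.
move=> Ms; have E : (u^T *m M *m v)^T = v^T *m M *m u.
  by rewrite !trmx_mul trmxK Ms mulmxA.
by rewrite /form -E [RHS]mxE.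
Qed.

Lemma formZ M a u : form M (a *: u) (a *: u) = a ^+ 2 * form M u u.
Proof.
by rewrite formZr /form [(a *: u)^T]linearZ /= -!scalemxAl mxE mulrA.
Qed.

Lemma form0r M u : form M u 0 = 0.
Proof. by rewrite /form mulmx0 mxE. Qed.

(* Three distinct points of a non-degenerate conic are not collinear. *)
Lemma columns_unit M (x : 'I_3 -> point) : M \in unitmx -> M^T = M ->
  injective x -> (forall i, form M (rep (x i)) (rep (x i)) = 0) ->
  columns (fun i => rep (x i)) \in unitmx.
Proof.
move=> Mu Ms xinj xM; pose u i := rep (x i).
have xn (i j : 'I_3) : i != j -> x i != x j by apply: contra_neq => /xinj.
have [i01 [i02 i12]] : i0 != i1 /\ i0 != i2 /\ i1 != i2.
  by rewrite -!val_eqE /= !inordK.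
rewrite unitmxE unitfE -det_tr; apply/negP => /det0P[w w0 wB].
have {wB} E : w 0 i0 *: u i0 + w 0 i1 *: u i1 + w 0 i2 *: u i2 = 0.
  have := congr1 trmx wB; rewrite trmx_mul trmxK trmx0 mul_columns big_ord3 !mxE.
  exact.
have wn0 : w 0 i0 != 0 /\ w 0 i1 != 0.
  split; apply: contra_neq w0 => z; move: E; rewrite z scale0r ?add0r ?addr0.
    move=> /collinear_points/(_ (xn _ _ i12))[E1 E2].
    by apply/rowP; apply: ord3P; rewrite mxE.
  move=> /collinear_points/(_ (xn _ _ i02))[E1 E2].
  by apply/rowP; apply: ord3P; rewrite mxE.
have Ef i : w 0 i0 * form M (u i) (u i0) + w 0 i1 * form M (u i) (u i1)
    + w 0 i2 * form M (u i) (u i2) = 0.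
  by rewrite -!formZr -!formDr E form0r.
have n2 : 2%:R != 0 :> K by rewrite pnatr_eq0.
(* Pairing the relation [E] with the three vectors and combining the results with weights [w0],
   [w1], [- w2] leaves [2 * w0 * w1 * c]. The first two vectors then span a totally isotropic
   plane. *)
have c0 : form M (u i0) (u i1) = 0.
  apply: (mulfI (mulf_neq0 n2 (mulf_neq0 wn0.1 wn0.2))).
  have := Ef i0; have := Ef i1; have := Ef i2; rewrite !xM.
  rewrite ![form M (u i1) (u i0)]formC // ![form M (u i2) _]formC //.
  move=> E2 E1 E0; rewrite mulr0.
  move: E0 E1 E2; set a := form M (u i1) (u i2); set b := form M (u i0) (u i2).
  set c := form M (u i0) (u i1); set w0' := w 0 i0; set w1 := w 0 i1; set w2 := w 0 i2.
  move=> E0 E1 E2; transitivity (w0' * (w0' * 0 + w1 * c + w2 * b)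
    + w1 * (w0' * c + w1 * 0 + w2 * a) - w2 * (w0' * b + w1 * a + w2 * 0)).
    by ring.
  by rewrite E0 E1 E2; ring.
apply: (isotropic_plane (u := u i0) (v := u i1) Mu); rewrite ?xM //.
  by move=> a b /collinear_points; apply; apply: xn.
by rewrite formC.
Qed.

Lemma form_congr M (A : 'M[K]_3) u v :
  form (A^T *m M *m A) u v = form M (A *m u) (A *m v).
Proof. by rewrite /form trmx_mul !mulmxA. Qed.

Lemma unitmx_zdiag f : zdiag f \in unitmx -> forall i, f i != 0.
Proof.
rewrite unitmxE unitfE det_zdiag !mulf_eq0 !negb_or -!andbA.
by move=> /and4P[_ f0 f1 f2]; apply: ord3P.
Qed.

Lemma OO_normal_form C D : OO (C, D) -> exists (A : 'M[K]_3) f g,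
  [/\ A \in unitmx, A^T *m rep C *m A = zdiag f, A^T *m rep D *m A = zdiag g,
      esym1 f = 0 & esym1 g = 0].
Proof.
case=> /= Cs Ds Cu Du [s [su s4 sP]].
case: s su s4 sP => [|x0 [|x1 [|x2 [|x3 [|? ?]]]]] // su _ sP.
have [[d01 d02 d12] [d30 d31 d32]] := uniq_seq4 su.
pose x : 'I_3 -> point := vec3 x0 x1 x2.
have xinj : injective x := vec3_inj d01 d02 d12.
have x3n : forall i, x3 != x i :=
  @vec3_ind _ (fun y => x3 != y) _ _ _ d30 d31 d32.
have conicP y (E : conics) : on_conic y E -> form (rep E) (rep y) (rep y) = 0.
  by rewrite /on_conic /form => ->; rewrite mxE.
have sCD y : y = x0 \/ y = x1 \/ y = x2 \/ y = x3 -> on_conic y C /\ on_conic y D.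
  by move=> /mem_seq4/sP.
have xCD : forall i, on_conic (x i) C /\ on_conic (x i) D.
  by apply: (@vec3_ind _ (fun y => on_conic y C /\ on_conic y D)); apply: sCD;
    [left | right; left | right; right; left].
have [x3C x3D] : on_conic x3 C /\ on_conic x3 D.
  by apply: sCD; right; right; right.
have xC i := conicP _ _ (xCD i).1; have xD i := conicP _ _ (xCD i).2.
have Bu := columns_unit Cu Cs xinj xC; set B := columns _ in Bu.
pose w := invmx B *m rep x3; have Bw : B *m w = rep x3 by rewrite mulKVmx.
have [h hE] := columns_zdiag Cs xC; rewrite -/B in hE.
have h0 : forall i, h i != 0.
  by apply: unitmx_zdiag; rewrite -hE !unitmx_mul unitmx_tr Bu Cu.
have := conicP _ _ x3C; rewrite -Bw -form_congr hE form_zdiag => /eqP.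
rewrite mulf_eq0 pnatr_eq0 /= => /eqP hw.
have rep3 i : rep x3 != w i 0 *: rep (x i).
  apply/eqP => E; case/eqP: (x3n i); apply: represents_inj (represents_rep x3) _.
  rewrite E; apply: representsZ (represents_rep _).
  by apply: contra_neq (rep_neq0 x3) => wi; rewrite E wi scale0r.
have wE : rep x3 = w i0 0 *: rep (x i0) + w i1 0 *: rep (x i1) + w i2 0 *: rep (x i2).
  by rewrite -Bw mul_columns big_ord3.
(* A vanishing coordinate would force a second one to vanish, by the conic equation [hw], and [x3]
   would be one of the other three points. *)
have w0 : forall i, w i 0 != 0.
  apply: ord3P; apply/eqP => z; move: hw;
    rewrite z !(mulr0, mul0r, addr0, add0r) => /eqP;
    rewrite -mulrA !mulf_eq0 (negPf (h0 _)) /= => /orP[]/eqP z'.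
  - by case/eqP: (rep3 i2); rewrite {1}wE z z' !scale0r !add0r.
  - by case/eqP: (rep3 i1); rewrite {1}wE z z' !scale0r addr0 add0r.
  - by case/eqP: (rep3 i2); rewrite {1}wE z z' !scale0r !add0r.
  - by case/eqP: (rep3 i0); rewrite {1}wE z z' !scale0r !addr0.
  - by case/eqP: (rep3 i1); rewrite {1}wE z z' !scale0r addr0 add0r.
  - by case/eqP: (rep3 i0); rewrite {1}wE z z' !scale0r !addr0.
(* The rescaled columns add up to [rep x3], so the fourth point gets the coordinates [(1, 1, 1)]. *)
pose V i := w i 0 *: rep (x i).
have [f fE] : exists f, (columns V)^T *m rep C *m columns V = zdiag f.
  by apply: columns_zdiag => // i; rewrite formZ xC mulr0.
have [g gE] : exists g, (columns V)^T *m rep D *m columns V = zdiag g.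
  by apply: columns_zdiag => // i; rewrite formZ xD mulr0.
have V1 : columns V *m const_mx 1 = rep x3.
  by rewrite mul_columns big_ord3 !mxE !scale1r wE.
have sum0 (E : conics) h' : on_conic x3 E ->
    (columns V)^T *m rep E *m columns V = zdiag h' -> esym1 h' = 0.
  move=> /conicP; rewrite -V1 -form_congr => + hE'.
  rewrite hE' form_zdiag !mxE !mulr1 => /eqP.
  by rewrite mulf_eq0 pnatr_eq0 /= => /eqP.
exists (columns V), f, g; split=> //; [|exact: sum0 fE|exact: sum0 gE].
have -> : columns V = B *m diag_mx w^T.
  by apply/matrixP => i j; rewrite mul_mx_diag !mxE mulrC.
rewrite unitmx_mul Bu unitmxE det_diag unitfE.
by apply/prodf_neq0 => i _; rewrite mxE.
Qed.

End NormalForm.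

Lemma no_injection_into_seq4 (T : eqType) (s : seq T) (h : nat -> T) :
  size s = 4%N -> injective h -> ~ forall n, h n \in s.
Proof.
move=> s4 hinj hs; have : (size (map h (iota 0 5)) <= size s)%N.
  by apply: uniq_leq_size => [|_ /mapP[n _ ->]//]; rewrite map_inj_uniq ?iota_uniq.
by rewrite size_map size_iota s4.
Qed.

(** * Roots of the pencil and the space of orbits *)

Section Roots.
Variable K : numClosedFieldType.
Implicit Types (f g r : 'I_3 -> K) (l : proj 'rV[K]_3) (x : OO_type K).

Local Notation conics := (proj 'M[K]_3).
Implicit Types (C D : conics).

Lemma zdiagZ a f : a *: zdiag f = zdiag (fun i => a * f i).
Proof.
by apply/matrixP; apply: ord3P; apply: ord3P; rewrite !mxE !vec3E ?mulr0.
Qed.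

(** Proportional forms define the same conic, whose infinitely many points would all be common to
    the pair, against the count of four. *)
Lemma OO_not_proportional C D (A : 'M[K]_3) f g k : OO (C, D) -> A \in unitmx ->
  A^T *m rep C *m A = zdiag f -> A^T *m rep D *m A = zdiag g ->
  (forall i, f i != 0) -> ~ g =1 fun i => k * f i.
Proof.
case=> /= _ _ _ _ [s [_ s4 sP]] Au fE gE f0 gk.
pose mu n : K := n.+1%:R.
have mu0 n : mu n != 0 by rewrite pnatr_eq0.
(* [u n] is the second intersection of the conic with the line [x = mu n * y] through its point
   [[0 : 0 : 1]]. *)
pose tau n := - (f i0 + f i1 * mu n).
pose u n := col3 (mu n * tau n) (tau n) (f i2 * mu n).
have fu n : form (zdiag f) (u n) (u n) = 0.
  by rewrite form_zdiag_col3 /tau; ring.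
have un n : u n != 0.
  apply/eqP => /colP/(_ i2)/eqP; rewrite !mxE vec3E mulf_eq0.
  by rewrite (negPf (f0 _)) (negPf (mu0 _)).
have /choice[h hP] : forall n, exists p, represents (A *m u n) p.
  move=> n; apply: represents_exists; apply: contra_neq (un n) => Aun.
  by rewrite -[u n](mulKmx Au) Aun mulmx0.
have on n (E : conics) e : A^T *m rep E *m A = zdiag e ->
    form (zdiag e) (u n) (u n) = 0 -> on_conic (h n) E.
  move=> eE; rewrite -eE form_congr => /eqP; rewrite -formE => /eqP.
  exact: (on_conicE (hP n) (represents_rep E)).2.
apply: (no_injection_into_seq4 s4 (h := h)) => [m n hmn|n]; last first.
  apply/sP; split; first exact: on fE (fu n).
  apply: on gE _; have -> : zdiag g = k *: zdiag f.
    by rewrite zdiagZ; congr zdiag; apply/funext.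
  by rewrite /form -scalemxAr -scalemxAl [LHS]mxE [X in k * X]fu mulr0.
have [a [a0 E]] : exists a, a != 0 /\ u m = a *: u n.
  have [b b0 Eb] := hP m; have [c c0 Ec] := represents_repE (hP n).
  exists (b * c); rewrite mulf_neq0 //; split=> //.
  by rewrite -[u m](mulKmx Au) Eb hmn Ec scalerA -scalemxAr mulKmx.
have := congr1 (fun t : 'cV[K]_3 => t i0 0) E.
have := congr1 (fun t : 'cV[K]_3 => t i1 0) E.
have := congr1 (fun t : 'cV[K]_3 => t i2 0) E.
rewrite !mxE !vec3E => E2 E1 E0.
have {}E2 : mu m = a * mu n by apply: (mulfI (f0 i2)); rewrite E2; ring.
suff mn : mu m = mu n by apply/eqP; move/eqP: mn; rewrite eqr_nat eqSS.
have [t0|t0] := eqVneq (tau m) 0.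
  move: E1; rewrite t0 => /esym/eqP; rewrite mulf_eq0 (negPf a0) /= => /eqP t1.
  apply: (mulfI (f0 i1)); apply: (addrI (f i0)); apply: oppr_inj.
  by rewrite -/(tau m) -/(tau n) t0 t1.
by apply: (mulIf t0); rewrite E0 E1; ring.
Qed.

Lemma OO_roots C D : OO (C, D) -> exists c r, [/\ c != 0, forall i, r i != 0,
  injective r & pencil (C, D) = c *: \prod_(i < 3) ('X - (r i)%:P)].
Proof.
move=> CDO; have [A [f [g [Au fE gE sf sg]]]] := OO_normal_form CDO.
have [_ _ /= Cu Du _] := CDO.
have f0 : forall i, f i != 0.
  by apply: unitmx_zdiag; rewrite -fE !unitmx_mul unitmx_tr Au Cu.
have g0 : forall i, g i != 0.
  by apply: unitmx_zdiag; rewrite -gE !unitmx_mul unitmx_tr Au Du.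
have np k := OO_not_proportional (k := k) CDO Au fE gE f0.
have dA : \det A ^+ 2 != 0 by rewrite expf_neq0 // -unitfE -unitmxE.
exists ((\det A ^+ 2)^-1 * (2%:R * (f i0 * f i1 * f i2))).
exists (fun i => - g i / f i); split.
- by rewrite mulf_neq0 ?invr_eq0 // !mulf_neq0 // pnatr_eq0.
- by move=> i; rewrite mulf_neq0 ?invr_eq0 ?oppr_eq0.
(* Two equal roots give a common ratio [g i / f i] at two indices; the vanishing sums extend it to
   the third, against [np]. *)
- have f2E : f i2 = - (f i0 + f i1) by apply/eqP; rewrite -addr_eq0 addrC; apply/eqP.
  have g2E : g i2 = - (g i0 + g i1) by apply/eqP; rewrite -addr_eq0 addrC; apply/eqP.
  have cross i j : - g i / f i = - g j / f j -> g j = g i / f i * f j.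
    by rewrite !mulNr => /oppr_inj ->; rewrite divfK.
  apply: ord3_inj; apply/eqP => /cross E.
  + apply: (np (g i0 / f i0)); apply: ord3P; rewrite ?divfK //.
    by rewrite g2E f2E E; field.
  + apply: (np (g i0 / f i0)); apply: ord3P; rewrite ?divfK //.
    have -> : g i1 = - (g i0 + g i2) by rewrite g2E; ring.
    by rewrite E f2E; field.
  + apply: (np (g i1 / f i1)); apply: ord3P; rewrite ?divfK //.
    have -> : g i0 = - (g i1 + g i2) by rewrite g2E; ring.
    by rewrite E f2E; field.
- rewrite -scalerA -matrix_pencil_zdiag // -fE -gE matrix_pencil_congr.
  by rewrite scalerA mulVf ?scale1r.
Qed.

(** The vector [v] and the roots from [OO_roots] factor the same polynomial, so they agree up to
    order and [l] inherits distinct nonzero coordinates. *)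
Lemma root_class_coord (m : MM K) l : root_class m l -> exists x c a,
  [/\ projM x = m, c != 0, a != 0, pencil (val x) =
      c *: \prod_(i < 3) ('X - (a * coord l i)%:P) & UU l].
Proof.
move=> [x [xm [v [a a0 vE] Ep]]]; have CDO := set_mem (valP x).
have [c [r [c0 r0 rinj Er]]] : exists c r, [/\ c != 0, forall i, r i != 0,
    injective r & pencil (val x) = c *: \prod_(i < 3) ('X - (r i)%:P)].
  by case: (val x) CDO => C D; apply: OO_roots.
have lc : lead_coef (pencil (val x)) = c.
  by rewrite Er lead_coefZ (monicP (monic_prod_XsubC _ _ _)) mulr1.
have vi i : v 0 i = a * coord l i by rewrite vE mxE.
rewrite lc in Ep.
have Epr : \prod_(i < 3) ('X - (v 0 i)%:P) =
    \prod_(i < 3) ('X - (r i)%:P).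
  by apply: (scalerI c0); rewrite -Ep.
have [s sE] : exists s : 'S_3, r \o s =1 v 0.
  by have E := coef_prod_XsubC3 r; rewrite -Epr in E; apply: eq_esym_perm;
    [apply: oppr_inj; rewrite -E | rewrite -E | apply: oppr_inj; rewrite -E];
    rewrite coef_prod_XsubC3.
exists x, c, a; split=> //.
  by rewrite Ep; congr (_ *: _); apply: eq_bigr => i _; rewrite vi.
split=> [i|i j Eij].
  have := r0 (s i); rewrite -[r (s i)]/((r \o s) i) sE vi.
  by rewrite mulf_eq0 negb_or => /andP[].
by apply/(@perm_inj _ s)/rinj; rewrite -![r (s _)]/((r \o s) _) !sE !vi Eij.
Qed.

Lemma root_class_exists x : exists l, root_class (projM x) l.
Proof.
have CDO := set_mem (valP x).
have [c [r [c0 r0 rinj Er]]] : exists c r, [/\ c != 0, forall i, r i != 0,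
    injective r & pencil (val x) = c *: \prod_(i < 3) ('X - (r i)%:P)].
  by case: (val x) CDO => C D; apply: OO_roots.
have [l [_ [_ _ rl _]]] := UU_exists r0 rinj.
exists l, x; split=> //; exists (\row_i r i) => //.
rewrite {1}Er; congr (_ *: _).
  by rewrite Er lead_coefZ (monicP (monic_prod_XsubC _ _ _)) mulr1.
by apply: eq_bigr => i _; rewrite mxE.
Qed.

Lemma root_class_onto l : UU l -> exists x, root_class (projM x) l.
Proof.
move=> [l0 linj]; set g := coord l in l0 linj.
have gn (i j : 'I_3) : i != j -> g i - g j != 0.
  by rewrite subr_eq0; apply: contra_neq => /linj.
have [i01 [i02 i12]] : i0 != i1 /\ i0 != i2 /\ i1 != i2.
  by rewrite -!val_eqE /= !inordK.
(* Up to sign, [f] is the cross product of [(1, 1, 1)] and [g], so [f] and its product with [g] both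
   have sum 0. The sign in [h] makes the [g i] the roots, up to scale. *)
pose f := vec3 (g i1 - g i2) (g i2 - g i0) (g i0 - g i1).
have f0 : forall i, f i != 0.
  by apply: ord3P; rewrite /f vec3E gn // eq_sym.
pose h i := - g i; have h0 i : h i != 0 by rewrite oppr_eq0.
have hinj : injective h by move=> i j /oppr_inj/linj.
have sf : esym1 f = 0 by rewrite /esym1 /f !vec3E; ring.
have sh : esym1 (fun i => h i * f i) = 0 by rewrite /esym1 /f /h !vec3E; ring.
have zdiag_neq0 (e : 'I_3 -> K) : (forall i, e i != 0) -> zdiag e != 0.
  move=> e0; apply/eqP => /matrixP/(_ i0 i1)/eqP.
  by rewrite !mxE !vec3E (negPf (e0 _)).
have [C fC] := @represents_exists K 'M[K]_3 _ (zdiag_neq0 _ f0).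
have [D hD] :=
  @represents_exists K 'M[K]_3 _ (zdiag_neq0 _ (fun i => mulf_neq0 (h0 i) (f0 i))).
have CDO := OO_zdiag f0 h0 hinj sf sh fC hD.
have [a a0 Ea] := represents_repE fC; have [b b0 Eb] := represents_repE hD.
have xO : (C, D) \in @OO K by exact: mem_set.
exists (exist _ (C, D) xO), (exist _ (C, D) xO); split=> //.
have E : pencil (C, D) = (2%:R * (a * f i0 * (a * f i1) * (a * f i2))) *:
    \prod_(i < 3) ('X - (b / a * g i)%:P).
  rewrite -[pencil _]/(matrix_pencil _ _) Ea Eb !zdiagZ matrix_pencil_zdiag; last first.
    by move=> i; rewrite mulf_neq0.
  congr (_ *: _); apply: eq_bigr => i _; congr ('X - _%:P).
  by rewrite /h; field; rewrite a0 f0.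
exists ((b / a) *: rep l).
  by apply: representsZ (represents_rep l); rewrite mulf_neq0 ?invr_eq0.
rewrite [val _]/= {1}E; congr (_ *: _).
  by rewrite E lead_coefZ (monicP (monic_prod_XsubC _ _ _)) mulr1.
by apply: eq_bigr => i _; rewrite mxE.
Qed.

Lemma Cayley_root_class x l : root_class (projM x) l ->
  Cayley K (val x) <-> Cayley_poly.@[coord l] = 0.
Proof.
move=> /root_class_coord[y [c [a [yx c0 a0 Ey lU]]]].
have xy : G_orbit (val x) (val y) by move: yx => /esym/eqmodP/asboolP.
have -> : Cayley K (val x) <-> Cayley K (val y).
  by split; apply: Cayley_orbit => //; apply: G_orbit_sym.
rewrite CayleyP Ey !coefZ !coef_prod_XsubC3.
have -> : OO (val y) <-> True by split=> // _; exact: set_mem (valP y).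
split=> [[_ H]|H].
  apply: (mulfI (mulf_neq0 (expf_neq0 2 c0) (expf_neq0 4 a0))).
  rewrite mulr0 -mulrA -Cayley_polyZ Cayley_polyE.
  set h := fun i => a * coord l i in H *.
  transitivity (4%:R * (c * - esym3 h) * (c * - esym1 h) - (c * esym2 h) ^+ 2).
    by ring.
  by rewrite H subrr.
split=> //; have := Cayley_polyZ (coord l) a; rewrite H mulr0 Cayley_polyE => /eqP.
rewrite subr_eq0 => /eqP {}H; rewrite exprMn -H; ring.
Qed.

Lemma Cayley_image_zero_locus : Cayley_image K = zero_locus Cayley_poly.
Proof.
apply/seteqP; split=> [_ [x Cx <-]|m [l ml lC]].
  have [l xl] := root_class_exists x; exists l => //.
  exact: (Cayley_root_class xl).1.
have [x [xm _]] := ml; exists x => //; rewrite -xm in ml.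
exact: (Cayley_root_class ml).2.
Qed.

Lemma in_US3_zero_locus : in_US3 (zero_locus (@Cayley_poly K)) = @Cayley_curve K.
Proof.
apply/seteqP; split=> [_ [m [l [[l' ml' l'C] ml ->]]]|_ [l [lU lC ->]]].
  have [_ [_ [_ [_ _ _ _ lU]]]] := root_class_coord ml; exists l; split=> //.
  have [x [xm _]] := ml; rewrite -xm in ml ml'.
  exact/(Cayley_root_class ml).1/(Cayley_root_class ml').2.
have [x xl] := root_class_onto lU; exists (projM x), l; split=> //.
by exists l.
Qed.

End Roots.

(** * The Cayley set and its image in the space of orbits *)

Theorem proposition5 (R : realType) :
  (forall CD, Cayley R[i] CD -> G_orbit CD `<=` Cayley R[i]) /\
  zariski_closed (Cayley_image R[i]) /\
  Cayley_image R[i] = zero_locus Cayley_poly /\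
  irreducible_mpoly (@Cayley_poly R[i]) /\
  smooth_algebraic (zero_locus (@Cayley_poly R[i])).
Proof.
split=> [CD CDC CD' /Cayley_orbit|]; first exact.
rewrite /zariski_closed /smooth_algebraic Cayley_image_zero_locus in_US3_zero_locus.
split; first exact: closed_Cayley_curve.
by split=> //; split; [exact: irreducible_Cayley_poly|exact: smooth_Cayley_curve].
Qed.
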